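(* Let $\bar A=(A_0,A_1)$ be a compatible couple of (quasi-)Banach spaces with $A_0\cap A_1\neq\{0\}$. Let $0<\theta,\theta_1<1$, $0<r,r_0,r_1,q_1\le\infty$, $a,a_1,b_0,b_1\in SV$, $\left\|s^{-1/r_0}b_0(s)\right\|_{r_0,(1,\infty)}<\infty$, and $\left\|s^{-1/r_1}\frac{b_1(s)}{a_1(s)}\right\|_{r_1,(1,\infty)}<\infty$. Put $c_0(t)=\left\|s^{-1/r_0}b_0(s)\right\|_{r_0,(t,\infty)}$, $c_1(t)=a_1(t)\left\|s^{-1/r_1}\frac{b_1(s)}{a_1(s)}\right\|_{r_1,(t,\infty)}$, and $\rho(t)=t^{\theta_1}\frac{c_0(t)}{c_1(t)}$ for $t>0$. Then $$\left(\bar A_{0,r_0,b_0},\bar A^{\mathcal L}_{\theta_1,r_1,b_1,q_1,a_1}\right)_{\theta,r,a}\cong\bar A_{\eta,r,a^{\#}},$$ where $\eta=\theta\theta_1$ and $a^{\#}(t)=c_0(t)^{1-\theta}c_1(t)^{\theta}a(\rho(t))$.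
   Context: For a compatible couple $\bar X=(X_0,X_1)$ of (quasi-)Banach spaces, $f\in X_0+X_1$ and $t>0$, $K(t,f)=K(t,f;\bar X)=\inf\{\|f_0\|_{X_0}+t\|f_1\|_{X_1}: f=f_0+f_1,\ f_i\in X_i\}$. $\|\cdot\|_{q,(c,d)}$ ($0<q\le\infty$) is the usual (quasi-)norm of the Lebesgue space $L_q$ on the interval $(c,d)$ with Lebesgue measure (variable of integration: the displayed variable; $1/\infty=0$). $SV$ is the set of positive Lebesgue measurable functions $b$ on $(0,\infty)$ that are slowly varying: for each $\varepsilon>0$, $t^{\varepsilon}b(t)$ is equivalent to an increasing function and $t^{-\varepsilon}b(t)$ is equivalent to a decreasing function, where two positive functions are equivalent if each is bounded by a constant multiple of the other. For $0\le\theta\le1$, $0<q\le\infty$, $b\in SV$, $\bar X_{\theta,q,b}=(X_0,X_1)_{\theta,q,b}$ is the space of $f\in X_0+X_1$ with $\|f\|=\left\|u^{-\theta-1/q}b(u)K(u,f)\right\|_{q,(0,\infty)}<\infty$. For $0<\sigma<1$, $0<r,q\le\infty$, $a,b\in SV$, $\bar X^{\mathcal L}_{\sigma,r,b,q,a}$ is the space of $f\in X_0+X_1$ with $\|f\|=\left\|t^{-1/r}\frac{b(t)}{a(t)}\left\|u^{-\sigma-1/q}a(u)K(u,f)\right\|_{q,(0,t)}\right\|_{r,(0,\infty)}<\infty$. $X\cong Y$ means that $X$ and $Y$ are continuously embedded in each other (same space, equivalent quasi-norms). *)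

(* Defs.v *)
(* MathComp / MathComp-Analysis. *)
From HB Require Import structures.
From mathcomp Require Import all_boot all_order all_algebra.
From mathcomp Require Import complex.
From mathcomp Require Import all_classical all_reals all_analysis.

Set Implicit Arguments.
Unset Strict Implicit.
Unset Printing Implicit Defensive.

Import Order.TTheory GRing.Theory Num.Theory.
Import numFieldNormedType.Exports.

Local Open Scope classical_set_scope.
Local Open Scope ring_scope.

(* Vector spaces are over either the real or the complex numbers. *)
Variant scalar_kind := real_scalars | complex_scalars.

Definition scalar_field (R : realType) (k : scalar_kind) : numFieldType :=
  match k with
  | real_scalars => R
  | complex_scalars => R[i]
  end.

(* The norm of the numFieldType R[i] is R[i]-valued with zero imaginary part,
   hence the projection. *)
Definition modulus (R : realType) (k : scalar_kind) : scalar_field R k -> R :=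
  match k return scalar_field R k -> R with
  | real_scalars => fun x => `|x|
  | complex_scalars => fun x => complex.Re `|x|
  end.

Section quasi_normed_spaces.
Context (R : realType) (k : scalar_kind).
Context (V : topologicalLmodType (scalar_field R k)).

(* A candidate quasi-normed subspace of the ambient space V. The value of
   [qnorm] is meaningful on [carrier] only, where it has to be finite. *)
Record qspace := QSpace { carrier : set V ; qnorm : V -> \bar R }.

Implicit Types X Y : qspace.

Definition linear_subspace (E : set V) :=
  [/\ E 0, (forall x y, E x -> E y -> E (x + y)) &
      (forall (l : scalar_field R k) x, E x -> E (l *: x))].

Definition quasi_norm X :=
  [/\ (forall x, carrier X x -> (0 <= qnorm X x < +oo)%E),
      (forall x, carrier X x -> qnorm X x = 0%E -> x = 0),
      (forall (l : scalar_field R k) x, carrier X x ->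
        qnorm X (l *: x) = ((modulus l)%:E * qnorm X x)%E) &
      (exists2 C : R, 1 <= C &
        forall x y, carrier X x -> carrier X y ->
          (qnorm X (x + y)%R <= C%:E * (qnorm X x + qnorm X y))%E)].

Definition cauchy_complete X :=
  forall u : nat -> V, (forall n, carrier X (u n)) ->
    (forall e : R, 0 < e -> exists N, forall m n, (N <= m)%N -> (N <= n)%N ->
      (qnorm X (u m - u n)%R < e%:E)%E) ->
    exists2 l, carrier X l &
      (forall e : R, 0 < e -> exists N, forall n, (N <= n)%N ->
        (qnorm X (u n - l)%R < e%:E)%E).

Definition quasi_banach X :=
  [/\ linear_subspace (carrier X), quasi_norm X & cauchy_complete X].

(* Continuity of the inclusion X -> V; by linearity, continuity at 0. *)
Definition continuously_included X :=
  forall U : set V, nbhs (0 : V) U ->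
    exists2 d : R, 0 < d &
      forall x, carrier X x -> (qnorm X x < d%:E)%E -> U x.

Definition compatible_couple X0 X1 :=
  [/\ hausdorff_space V,
      quasi_banach X0, quasi_banach X1,
      continuously_included X0 & continuously_included X1].

Definition sum_space X0 X1 : set V :=
  [set f | exists f0 f1, [/\ carrier X0 f0, carrier X1 f1 & f = f0 + f1]].

Definition Kfun X0 X1 (t : R) (f : V) : \bar R :=
  ereal_inf [set y | exists f0 f1, [/\ carrier X0 f0, carrier X1 f1,
    f = f0 + f1 & y = (qnorm X0 f0 + t%:E * qnorm X1 f1)%E]].

Definition continuously_embedded X Y :=
  carrier X `<=` carrier Y /\
  exists2 C : R, 0 < C &
    forall f, carrier X f -> (qnorm Y f <= C%:E * qnorm X f)%E.

Definition space_iso X Y :=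
  continuously_embedded X Y /\ continuously_embedded Y X.

End quasi_normed_spaces.

Notation "X ≅ Y" := (space_iso X Y) (at level 70, no associativity).

Section slowly_varying.
Context (R : realType).

(* R with the sigma-algebra of Lebesgue measurable sets (the domain of
   [completed_lebesgue_measure]). *)
Definition lebesgueTypeR := caratheodory_type (wlength (@idfun R))^*%mu.

(* The (quasi-)norm of L_q on D. *)
Definition Lq_on (q : \bar R) (D : set R) (f : R -> \bar R) : \bar R :=
  ('N[@completed_lebesgue_measure R]_q[f \_ D])%E.

(* 1/q, with 1/oo = 0 since [fine +oo = 0]. *)
Definition recip (q : \bar R) : R := (fine q)^-1.

Definition pos_on_half_line (f : R -> R) := forall t, 0 < t -> 0 < f t.

Definition equivalent (f g : R -> R) :=
  exists2 C : R, 0 < C & forall t, 0 < t -> f t <= C * g t /\ g t <= C * f t.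

Definition equiv_increasing (f : R -> R) := exists g : R -> R,
  [/\ pos_on_half_line g,
      (forall s t, 0 < s -> s <= t -> g s <= g t) & equivalent f g].

Definition equiv_decreasing (f : R -> R) := exists g : R -> R,
  [/\ pos_on_half_line g,
      (forall s t, 0 < s -> s <= t -> g t <= g s) & equivalent f g].

Definition SV (b : R -> R) :=
  [/\ pos_on_half_line b,
      measurable_fun (`]0, +oo[ : set lebesgueTypeR)
        (b : lebesgueTypeR -> measurableTypeR R) &
      forall e : R, 0 < e ->
        equiv_increasing (fun t => t `^ e * b t) /\
        equiv_decreasing (fun t => t `^ (- e) * b t)].

End slowly_varying.

Section interpolation_spaces.
Context (R : realType) (k : scalar_kind).
Context (V : topologicalLmodType (scalar_field R k)).
Implicit Types X : qspace V.

(* || u^(-sigma-1/q) a(u) K(u,f) ||_{q,D} *)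
Definition weighted_K_norm X0 X1 (sigma : R) (q : \bar R) (a : R -> R)
    (D : set R) (f : V) : \bar R :=
  Lq_on q D
    (fun u => ((u `^ (- sigma - recip q) * a u)%:E * Kfun X0 X1 u f)%E).

Definition interp_norm X0 X1 (theta : R) (q : \bar R) (b : R -> R) (f : V)
    : \bar R :=
  weighted_K_norm X0 X1 theta q b `]0, +oo[ f.

Definition interp X0 X1 (theta : R) (q : \bar R) (b : R -> R) : qspace V :=
  QSpace
    [set f | sum_space X0 X1 f /\ (interp_norm X0 X1 theta q b f < +oo)%E]
    (interp_norm X0 X1 theta q b).

Definition interpL_norm X0 X1 (sigma : R) (r : \bar R) (b : R -> R)
    (q : \bar R) (a : R -> R) (f : V) : \bar R :=
  Lq_on r `]0, +oo[
    (fun t => mule (t `^ (- recip r) * (b t / a t))%:E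
      (weighted_K_norm X0 X1 sigma q a `]0, t[ f)).

Definition interpL X0 X1 (sigma : R) (r : \bar R) (b : R -> R)
    (q : \bar R) (a : R -> R) : qspace V :=
  QSpace
    [set f | sum_space X0 X1 f /\
             (interpL_norm X0 X1 sigma r b q a f < +oo)%E]
    (interpL_norm X0 X1 sigma r b q a).

End interpolation_spaces.

(* || s^(-1/r) b(s) ||_{r, (t, oo)} *)
Definition tail_norm (R : realType) (r : \bar R) (b : R -> R) (t : R) : \bar R :=
  Lq_on r `]t, +oo[ (fun s => (s `^ (- recip r) * b s)%:E).

(* Main.v *)
(* Write [phi = K(., f; A0, A1)] and let [rho] be as in the statement. On the
   logarithmic scale [t = e^x] every weight is an exponential times a slowly
   varying function, and [phi] changes by a bounded factor over a unit step in
   [x]; hence each Lebesgue norm is equivalent to an l^q norm over the integers.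
   Measurability plays no role, because the integral of a nonnegative function,
   a supremum over the simple functions below it, is monotone.
   The theorem follows from two estimates of the K-functional of the outer
   couple: [c0(t) phi(t) <= C K(rho(t), f)] and, splitting [f = g + h] almost
   optimally at [t], an upper bound for [K(rho(t), f)] by norms of [phi] over
   [(0, t)] and [(t, oo)] whose weights, compared with that of the right-hand
   side of the theorem, decay geometrically away from [t]. Hardy's inequality
   and the substitution [u = rho(t)] conclude. *)
Require Import Defs.
From HB Require Import structures.
From mathcomp Require Import all_boot all_order all_algebra.
From mathcomp Require Import all_classical all_reals all_analysis.
From mathcomp Require Import complex measurable_realfun ess_sup_inf.
From mathcomp Require Import ring lra zify.

Set Implicit Arguments.
Unset Strict Implicit.
Unset Printing Implicit Defensive.

Import Order.TTheory GRing.Theory Num.Theory.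
Import numFieldNormedType.Exports.

Local Open Scope classical_set_scope.
Local Open Scope ring_scope.

(** * Sequence norms *)

(** The exponents r, r0, r1, q1 are unrelated and may be below 1, so neither Minkowski's inequality
    nor duality is at hand. Spare exponential decay replaces them: a factor e^(-delta |j-l|) is set
    aside, a sum over l is traded for a supremum times a convergent geometric series, and what
    remains is an interchange of two summations. In the logarithmic variable put W = rho^(-theta)
    a(rho). Its index of variation is -theta theta1, that of W rho is theta1 (1 - theta); these two
    numbers, together with 1 - theta1 for the part of h below t, are the source of all decay. The
    function a# is the one for which W c0 is the weight of the right-hand side, so multiplying the
    K-functional estimates by W leads to that weight. In general rho is neither monotone nor
    continuous, so u = rho(t) is no literal substitution: ln rho is only a quasi-isometry of the
    line, which suffices because the integrand changes by a bounded factor over bounded steps. The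
    inequality for K(t, f + g) carries a constant, so the K-functionals of g and h are controlled
    only up to constants. *)

Section sequence_norm.
Context {R : realType}.
Local Open Scope ereal_scope.
Implicit Types (q : \bar R) (x y z c : int -> \bar R) (k : int -> int -> \bar R).

(** Values are extended, so no summability has to be known in advance. The second branch serves
    [+oo]; the value [-oo] is excluded later by [0 < q]. *)
Definition lqnorm q x : \bar R :=
  if q is r%:E then (\esum_(i in [set: int]) x i `^ r) `^ r^-1
  else ereal_sup (range x).

Lemma ler_poweR (r : R) (u v : \bar R) :
  (0 <= r)%R -> 0 <= u -> u <= v -> u `^ r <= v `^ r.
Proof.
move=> r0 u0 uv; apply: gt0_ler_poweR => //.
  by rewrite in_itv/= u0 leey.
by rewrite in_itv/= (le_trans u0 uv) leey.
Qed.

Lemma poweR_invK (r : R) (u : \bar R) : (0 < r)%R -> 0 <= u ->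
  (u `^ r) `^ r^-1 = u.
Proof. by move=> r0 u0; rewrite -poweRrM mulfV ?gt_eqF// poweRe1. Qed.

Lemma poweRK (r : R) (u : \bar R) : (0 < r)%R -> 0 <= u ->
  (u `^ r^-1) `^ r = u.
Proof. by move=> r0 u0; rewrite -poweRrM mulVf ?gt_eqF// poweRe1. Qed.

Lemma esum_term (I : choiceType) (S : set I) (a : I -> \bar R) i :
  S i -> 0 <= a i -> a i <= \esum_(i in S) a i.
Proof.
move=> Si ai0; apply: esum_ge; exists [set i]; last by rewrite fsbig_set1.
by split; [exact: finite_set1|move=> _ ->].
Qed.

Lemma esumZ_le (I : choiceType) (S : set I) (c : \bar R) (a : I -> \bar R) :
  0 <= c -> (forall i, 0 <= a i) ->
  \esum_(i in S) (c * a i) <= c * \esum_(i in S) a i.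
Proof.
move=> c0 a0; apply: ge_ereal_sup => _ [F [fF FS] <-].
rewrite fsbig_finite//= -ge0_sume_distrr//.
apply: lee_wpmul2l => //; apply: esum_ge; exists F => //.
by rewrite fsbig_finite.
Qed.

Lemma lqnorm_ge0 q x : (forall i, 0 <= x i) -> 0 <= lqnorm q x.
Proof.
move=> x0; case: q => [r| |] /=; first exact: poweR_ge0.
all: by apply: (le_trans (x0 0%R)); apply: ereal_sup_ubound; exists 0%R.
Qed.

Lemma le_lqnorm q x y : 0 < q -> (forall i, 0 <= x i) ->
  (forall i, x i <= y i) -> lqnorm q x <= lqnorm q y.
Proof.
case: q => [r| |]//= q0 x0 xy.
  have r0 : (0 < r)%R by rewrite -lte_fin.
  apply: ler_poweR; first by rewrite invr_ge0 ltW.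
    by apply: esum_ge0 => i _; exact: poweR_ge0.
  by apply: le_esum => i _; apply: ler_poweR => //; rewrite ltW.
apply: ge_ereal_sup => _ [i _ <-]; apply: (le_trans (xy i)).
by apply: ereal_sup_ubound; exists i.
Qed.

Lemma eq_lqnorm q x y : (forall i, x i = y i) -> lqnorm q x = lqnorm q y.
Proof. by move=> /funext ->. Qed.

Lemma lqnorm_term q x i : 0 < q -> (forall i, 0 <= x i) -> x i <= lqnorm q x.
Proof.
case: q => [r| |]//= q0 x0; last by apply: ereal_sup_ubound; exists i.
have r0 : (0 < r)%R by rewrite -lte_fin.
rewrite -[leLHS](poweR_invK r0)//.
apply: ler_poweR; [by rewrite invr_ge0 ltW|exact: poweR_ge0|].
by apply: (@esum_term _ setT (fun i => x i `^ r)) => //; exact: poweR_ge0.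
Qed.

(* Replacing an inner sum or supremum by a pointwise supremum reduces every
   Hardy type inequality to an interchange of summations. *)
Lemma lqnorm_kernel q k x c z : 0 < q ->
  (forall j i, 0 <= k j i) -> (forall i, 0 <= x i) -> (forall j, 0 <= z j) ->
  (forall i, lqnorm q (k^~ i) <= c i) ->
  (forall j, z j <= ereal_sup (range (fun i => k j i * x i))) ->
  lqnorm q z <= lqnorm q (fun i => c i * x i).
Proof.
case: q => [r| |]// q0 k0 x0 z0 kc zk; last first.
  apply: ge_ereal_sup => _ [j _ <-]; apply: (le_trans (zk j)).
  apply: ge_ereal_sup => _ [i _ <-].
  apply: le_ereal_sup_tmp; exists (c i * x i); first by exists i.
  apply: lee_wpmul2r => //; apply: le_trans (kc i).
  by apply: ereal_sup_ubound; exists j.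
have r0 : (0 < r)%R by rewrite -lte_fin.
have c0 i : 0 <= c i by apply: le_trans (kc i); apply: lqnorm_ge0.
have zr j : z j `^ r <= \esum_(i in [set: int]) (k j i * x i) `^ r.
  have e0 : 0 <= \esum_(i in [set: int]) (k j i * x i) `^ r.
    by apply: esum_ge0 => i _; exact: poweR_ge0.
  rewrite -[leRHS](poweRK r0)//.
  apply: ler_poweR => //; first exact: ltW.
  apply: (le_trans (zk j)); apply: ge_ereal_sup => _ [i _ <-].
  rewrite -[leLHS](poweR_invK r0) ?mule_ge0//.
  apply: ler_poweR; [by rewrite invr_ge0 ltW|exact: poweR_ge0|].
  by apply: (@esum_term _ setT (fun i => (k j i * x i) `^ r)) => //;
    exact: poweR_ge0.
rewrite /=; apply: ler_poweR; first by rewrite invr_ge0 ltW.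
  by apply: esum_ge0 => i _; exact: poweR_ge0.
apply: (@le_trans _ _
  (\esum_(j in [set: int]) \esum_(i in [set: int]) (k j i * x i) `^ r)).
  exact: le_esum.
rewrite esum_esum; last by move=> *; exact: poweR_ge0.
rewrite (reindex_esum ([set: int] `*`` (fun=> [set: int])) _
  (fun p : int * int => (p.2, p.1))); last first.
  split=> [[a b]|[a b] [a' b'] _ _ /= [-> ->]|[a b] _]//.
  by exists (b, a).
rewrite -(@esum_esum _ _ _ [set: int] (fun=> [set: int])
  (fun i j => (k j i * x i) `^ r)); last by move=> *; exact: poweR_ge0.
apply: le_esum => i _.
under eq_esum do rewrite poweRM// muleC.
apply: (le_trans (esumZ_le _ (poweR_ge0 _ _) _)).
  by move=> *; exact: poweR_ge0.
rewrite poweRM// muleC; apply: lee_wpmul2r; first exact: poweR_ge0.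
have e0 : 0 <= \esum_(j in [set: int]) k j i `^ r.
  by apply: esum_ge0 => j _; exact: poweR_ge0.
rewrite -[leLHS](poweRK r0)//.
by apply: ler_poweR; rewrite ?poweR_ge0 ?kc// ltW.
Qed.

Lemma lqnorm_kernel1 q k x c z : 0 < q ->
  (forall j i, 0 <= k j i) -> (forall i, 0 <= x i) -> (forall j, 0 <= z j) ->
  (forall i, lqnorm q (k^~ i) <= c i) ->
  (forall j, exists i, z j <= k j i * x i) ->
  lqnorm q z <= lqnorm q (fun i => c i * x i).
Proof.
move=> q0 k0 x0 z0 kc zk; apply: (lqnorm_kernel q0 k0 x0 z0 kc) => j.
have [i zi] := zk j; apply: (le_trans zi).
by apply: ereal_sup_ubound; exists i.
Qed.

(** The factor may be [+oo]: in [hardy_tail] a supremum is pulled out before it is known to be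
    finite. *)
Lemma lqnormZ_lee q x (a : \bar R) : 0 < q -> 0 <= a -> (forall i, 0 <= x i) ->
  lqnorm q (fun i => a * x i) <= a * lqnorm q x.
Proof.
case: q => [r| |]//= q0 a0 x0; last first.
  apply: ge_ereal_sup => _ [i _ <-]; apply: lee_wpmul2l => //.
  by apply: ereal_sup_ubound; exists i.
have r0 : (0 < r)%R by rewrite -lte_fin.
have e0 : 0 <= \esum_(j in [set: int]) x j `^ r.
  by apply: esum_ge0 => j _; exact: poweR_ge0.
rewrite -[in leRHS](poweR_invK r0 a0) -poweRM// ?poweR_ge0//.
apply: ler_poweR; first by rewrite invr_ge0 ltW.
  by apply: esum_ge0 => i _; exact: poweR_ge0.
under eq_esum do rewrite poweRM//.
by apply: esumZ_le => *; exact: poweR_ge0.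
Qed.

Lemma lqnormZ_le q x (a : R) : 0 < q -> (0 <= a)%R -> (forall i, 0 <= x i) ->
  lqnorm q (fun i => a%:E * x i) <= a%:E * lqnorm q x.
Proof. by move=> q0 a0 x0; apply: lqnormZ_lee. Qed.

Lemma lqnormZ q x (a : R) : 0 < q -> (0 < a)%R -> (forall i, 0 <= x i) ->
  lqnorm q (fun i => a%:E * x i) = a%:E * lqnorm q x.
Proof.
move=> q0 a0 x0; apply/eqP; rewrite eq_le (lqnormZ_le q0 (ltW a0) x0)/=.
have h : lqnorm q x <= a^-1%:E * lqnorm q (fun i => a%:E * x i).
  rewrite (_ : lqnorm q x = lqnorm q (fun i => a^-1%:E * (a%:E * x i))).
    apply: lqnormZ_le => //; first by rewrite invr_ge0 ltW.
    by move=> i; rewrite mule_ge0// lee_fin ltW.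
  by apply: eq_lqnorm => i; rewrite muleA -EFinM mulVf ?gt_eqF// mul1e.
apply: (@le_trans _ _
  (a%:E * (a^-1%:E * lqnorm q (fun i => a%:E * x i)))).
  by apply: lee_wpmul2l; rewrite ?lee_fin ?(ltW a0).
by rewrite muleA -EFinM mulfV ?gt_eqF// mul1e.
Qed.

(** Puts an oscillation constant inside the sequence, so that lower bounds of Lebesgue norms, which
    ask for a pointwise inequality without constant, become applicable. *)
Lemma lqnorm_scale q x (a : R) : 0 < q -> (0 < a)%R -> (forall i, 0 <= x i) ->
  lqnorm q x = a%:E * lqnorm q (fun i => a^-1%:E * x i).
Proof.
move=> q0 a0 x0; rewrite lqnormZ ?invr_gt0//.
by rewrite muleA -EFinM mulfV ?gt_eqF// mul1e.
Qed.

Lemma lqnormD q : 0 < q -> exists2 C : R, (0 < C)%R &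
  forall x y, (forall i, 0 <= x i) -> (forall i, 0 <= y i) ->
  lqnorm q (fun i => x i + y i) <= C%:E * (lqnorm q x + lqnorm q y).
Proof.
have D2 (u v : \bar R) : 0 <= u -> 0 <= v -> u + v <= 2%:E * Order.max u v.
  move=> u0 v0; rewrite -[2%R]/(1 + 1)%R EFinD ge0_muleDl ?lee_fin// !mul1e.
  by apply: leeD; rewrite le_max lexx// orbT.
case: q => [r| |]//= q0; last first.
  exists 1%R; first exact: ltr01.
  move=> x y x0 y0; rewrite mul1e.
  apply: ge_ereal_sup => _ [i _ <-]; apply: leeD;
  by apply: ereal_sup_ubound; exists i.
have r0 : (0 < r)%R by rewrite -lte_fin.
(* The bound u + v <= 2 max(u, v) is used twice, on each pair of terms (factor 2) and on the pair of
   sums (factor 2^(1/r)); this also covers r < 1. *)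
exists (2 * 2 `^ r^-1)%R; first by rewrite mulr_gt0// powR_gt0.
move=> x y x0 y0.
set X := \esum_(i in _) x i `^ r; set Y := \esum_(i in _) y i `^ r.
have X0 : 0 <= X by apply: esum_ge0 => i _; exact: poweR_ge0.
have Y0 : 0 <= Y by apply: esum_ge0 => i _; exact: poweR_ge0.
have s0 : (0 <= r^-1)%R by rewrite invr_ge0 ltW.
have h : \esum_(i in [set: int]) (x i + y i) `^ r <= 2%:E `^ r * (X + Y).
  rewrite -esumD; try by move=> *; exact: poweR_ge0.
  apply: le_trans (esumZ_le _ (poweR_ge0 _ _) _); last first.
    by move=> i; rewrite adde_ge0// poweR_ge0.
  apply: le_esum => i _.
  apply: (@le_trans _ _ ((2%:E * Order.max (x i) (y i)) `^ r)).
    by apply: ler_poweR; [exact: ltW|exact: adde_ge0|exact: D2].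
  rewrite poweRM//; last by rewrite le_max x0.
  apply: lee_wpmul2l; first exact: poweR_ge0.
  by rewrite /Order.max; case: ifP => _; rewrite ?leeDl ?leeDr ?poweR_ge0.
apply: (@le_trans _ _ ((2%:E `^ r * (X + Y)) `^ r^-1)).
  by apply: ler_poweR => //; apply: esum_ge0 => i _; exact: poweR_ge0.
rewrite poweRM ?adde_ge0 ?poweR_ge0// poweR_invK// EFinM -muleA.
apply: lee_wpmul2l => //.
apply: (@le_trans _ _ ((2%:E * Order.max X Y) `^ r^-1)).
  by apply: ler_poweR; [|exact: adde_ge0|exact: D2].
rewrite poweRM//; last by rewrite le_max X0.
apply: lee_wpmul2l; first exact: poweR_ge0.
by rewrite /Order.max; case: ifP => _; rewrite ?leeDl ?leeDr ?poweR_ge0.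
Qed.

End sequence_norm.

(** * Summability of two-sided geometric weights *)

Section geometric_weights.
Context {R : realType}.
Local Open Scope ereal_scope.

Definition decay (e : R) (j l : int) : R :=
  expR (- (e * `|j%:~R - l%:~R|))%R.

Lemma decay_gt0 e j l : (0 < decay e j l)%R. Proof. exact: expR_gt0. Qed.

Lemma decay_sym e j l : decay e j l = decay e l j.
Proof. by rewrite /decay distrC. Qed.

Lemma esum_geometric_nat (s : R) : (0 < s)%R ->
  \esum_(n in [set: nat]) (expR (- (s * n%:R))%R)%:E <= ((1 - expR (- s))^-1)%R%:E.
Proof.
move=> s0; rewrite -nneseries_esumT; last by move=> n; rewrite lee_fin expR_ge0.
have e1 : (0 < 1 - expR (- s))%R by rewrite subr_gt0 -expR0 ltr_expR oppr_lt0.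
apply: lime_le.
  by apply: is_cvg_nneseries => n _ _; rewrite lee_fin expR_ge0.
apply: nearW => n; rewrite sumEFin lee_fin.
rewrite (eq_bigr (fun i => expR (- s) ^+ i)%R); last first.
  by move=> i _; rewrite -expRM_natl mulrN mulrC.
rewrite big_mkord -(ler_pM2l e1) mulfV ?gt_eqF//.
rewrite -opprB mulNr -subrX1 opprB lerBlDr lerDl.
by rewrite exprn_ge0// expR_ge0.
Qed.

Lemma esum_geometric (s : R) : (0 < s)%R -> exists2 M : R, (0 < M)%R &
  forall l, \esum_(j in [set: int]) (decay s j l)%:E <= M%:E.
Proof.
move=> s0; set m := ((1 - expR (- s))^-1)%R.
have m0 : (0 < m)%R by rewrite invr_gt0 subr_gt0 -expR0 ltr_expR oppr_lt0.
exists (m + m)%R; first by rewrite addr_gt0.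
move=> l.
have d0 i j : 0 <= (decay s i j)%:E by rewrite lee_fin ltW// decay_gt0.
rewrite (reindex_esum [set: int] _ (fun j => j + l)%R); last first.
  split=> // [i j _ _ /addIr//|j _]; exists (j - l)%R => //.
  by rewrite subrK.
rewrite (@eq_esum _ _ _ _ (fun j => (decay s j 0)%:E)); last first.
  by move=> j _; rewrite /decay rmorphD/= addrK subr0.
(* After the translation to [l = 0] the sum splits at the sign of [j]. Since [Negz n] is -(n+1), its
   term is below the n-th term of the same geometric series. *)
rewrite (esumID (range Posz))// EFinD !setTI.
apply: leeD.
  rewrite (reindex_esum [set: nat] _ Posz); last first.
    by split=> [n _|n n' _ _ []|j [n _ <-]]//; exists n.
  apply: le_trans (esum_geometric_nat s0); apply: le_esum => n _.
  by rewrite lee_fin ler_expR subr0 ger0_norm// ler0z.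
rewrite (reindex_esum [set: nat] _ Negz); last first.
  split=> [n _ [] []//|n n' _ _ []//|j jn].
  by case: j jn => n jn; [exfalso; apply: jn; exists n|exists n].
apply: le_trans (esum_geometric_nat s0); apply: le_esum => n _.
rewrite lee_fin ler_expR subr0 lerN2 ler_pM2l// NegzE mulrNz normrN.
by rewrite ger0_norm ?ler0z// ler_nat.
Qed.

Lemma lqnorm_decay (q : \bar R) (s : R) : 0 < q -> (0 < s)%R ->
  exists2 M : R, (0 < M)%R &
  forall l, lqnorm q (fun j => (decay s j l)%:E) <= M%:E.
Proof.
case: q => [r| |]//= q0 s0; last first.
  exists 1%R => // l; apply: ge_ereal_sup => _ [j _ <-].
  by rewrite lee_fin -expR0 ler_expR oppr_le0 mulr_ge0 ?(ltW s0).
have r0 : (0 < r)%R by rewrite -lte_fin.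
have [M M0 hM] := esum_geometric (mulr_gt0 s0 r0).
exists (M `^ r^-1)%R; first exact: powR_gt0.
move=> l; rewrite -poweR_EFin.
apply: ler_poweR; first by rewrite invr_ge0 ltW.
  by apply: esum_ge0 => i _; rewrite lee_fin powR_ge0.
apply: le_trans (hM l); apply: le_esum => j _.
by rewrite lee_fin /decay -expRM mulNr mulrAC.
Qed.
End geometric_weights.

(** * Discretisation of Lebesgue norms *)

Section discretisation.
Context {R : realType}.
Local Open Scope ereal_scope.
Notation mu := (@completed_lebesgue_measure R).
Implicit Types (q : \bar R) (x y : int -> \bar R) (D : set R) (G : R -> \bar R).

Definition cell (j : int) : set R := `[expR j%:~R, expR (j + 1)%:~R[%classic.

Definition cell_of (t : R) : int := Num.floor (ln t).

Lemma cell_pos j t : cell j t -> (0 < t)%R.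
Proof.
by rewrite /cell/= in_itv/= => /andP[+ _]; apply: lt_le_trans; exact: expR_gt0.
Qed.

Lemma cellP j t : cell j t <-> (0 < t)%R /\ cell_of t = j.
Proof.
split=> [tj|[t0 <-]].
  have t0 := cell_pos tj; split=> //; rewrite /cell_of.
  move: tj; rewrite /cell/= in_itv/= => /andP[jt tj].
  apply: floor_def.
  by rewrite -ler_expR -ltr_expR !lnK ?posrE// jt.
rewrite /cell/= in_itv/= -{2 3}(lnK (x := t))// ler_expR ltr_expR.
exact: floor_itv.
Qed.

Lemma measurable_cell j : measurable (cell j : set (lebesgueTypeR R)).
Proof. by apply: sub_caratheodory; exact: measurable_itv. Qed.

Lemma cell_measure j :
  mu (cell j) = (expR (j + 1)%:~R - expR j%:~R)%:E.
Proof.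
rewrite (_ : mu (cell j) = @lebesgue_measure R (cell j))//.
by rewrite lebesgue_measure_itv/= lte_fin ltr_expR ltr_int ltrDl ltr01 EFinB.
Qed.

Lemma integral_mono (f g : lebesgueTypeR R -> \bar R) :
  (forall t, 0 <= f t) -> (forall t, f t <= g t) ->
  \int[mu]_t f t <= \int[mu]_t g t.
Proof.
move=> f0 fg; rewrite !ge0_integralTE//; last first.
  by move=> t; exact: le_trans (fg t).
by apply: ereal_sup_le => _ [h hf <-]; exists h => // t; exact: le_trans (fg t).
Qed.

Definition step x (t : R) : \bar R := if (0 < t)%R then x (cell_of t) else 0.

Lemma step_ge0 x t : (forall j, 0 <= x j) -> 0 <= step x t.
Proof. by rewrite /step; case: ifP. Qed.

(** An enumeration of the integers, which turns a sum over cells into a series over [nat] that can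
    be integrated term by term. *)
Definition int_of_nat (n : nat) : int := if odd n then Negz n./2 else Posz n./2.

Lemma int_of_nat_bij : set_bij [set: nat] [set: int] int_of_nat.
Proof.
split=> // [m n _ _|[n|n] _]; rewrite /int_of_nat.
- have := odd_double_half m; have := odd_double_half n.
  by case: (odd m); case: (odd n) => // hn hm [mn]; rewrite -hm -hn mn.
- by exists n.*2 => //; rewrite odd_double doubleK.
- by exists n.*2.+1 => //=; rewrite odd_double/= uphalf_double.
Qed.

Lemma step_esum x t : (forall j, 0 <= x j) ->
  step x t = \esum_(j in [set: int]) (x j * (\1_(cell j) t)%:E).
Proof.
move=> x0.
have r0 j : 0 <= x j * (\1_(cell j) t)%:E by rewrite mule_ge0// lee_fin.
rewrite /step; case: ifPn => t0; last first.
  rewrite esum1// => j _; rewrite indicE; case: (boolP (t \in _)).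
    by rewrite inE => /cell_pos tj; rewrite tj in t0.
  by rewrite mule0.
rewrite (esumID [set cell_of t])// !setTI.
rewrite [X in _ + X]esum1 ?adde0; last first.
  move=> j /= jt; rewrite indicE; case: (boolP (t \in _)).
    by rewrite inE => /cellP[_ tj]; case: jt.
  by rewrite mule0.
rewrite esum_set1// indicE mem_set ?mule1//.
by apply/cellP.
Qed.

Lemma integral_step x : (forall j, 0 <= x j) ->
  \int[mu]_t step x t =
  \esum_(j in [set: int]) (x j * (expR (j + 1)%:~R - expR j%:~R)%:E).
Proof.
move=> x0.
have be := int_of_nat_bij; set e := int_of_nat in be *.
pose f n (t : lebesgueTypeR R) := x (e n) * (\1_(cell (e n)) t)%:E.
have f0 n t : 0 <= f n t by rewrite mule_ge0// lee_fin.
have mi n : measurable_fun [set: lebesgueTypeR R]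
    (EFin \o (\1_(cell (e n)) : lebesgueTypeR R -> R)).
  by apply/measurable_EFinP; apply: measurable_indic; exact: measurable_cell.
transitivity (\int[mu]_t (\sum_(n <oo) f n t)).
  apply: eq_integral => t _.
  rewrite nneseries_esumT; last by move=> n; exact: f0.
  by rewrite step_esum// (reindex_esum [set: nat] [set: int] e).
rewrite integral_nneseries//; last first.
  by move=> n; apply: measurable_funeM; exact: mi.
rewrite nneseries_esumT; last by move=> n; apply: integral_ge0 => t _; exact: f0.
rewrite (reindex_esum [set: nat] [set: int] e)//; apply: eq_esum => n _.
rewrite (ge0_integralZl mu _ (mi n))//; last by move=> t _ /=; rewrite lee_fin.
rewrite integral_indic//; last exact: measurable_cell.
by rewrite setIT -cell_measure.
Qed.

End discretisation.

(** * Comparison of Lebesgue norms with sequence norms *)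

Section lebesgue_norm.
Context {R : realType}.
Local Open Scope ereal_scope.
Notation mu := (@completed_lebesgue_measure R).
Implicit Types (q : \bar R) (x y : int -> \bar R) (D : set R) (G : R -> \bar R).

(** Discharges the guard in the norm for [+oo], which is the essential supremum when the whole space
    has positive measure. *)
Lemma muT_gt0 : 0 < mu [set: _].
Proof.
apply: (@lt_le_trans _ _ (mu (cell 0))).
  by rewrite cell_measure lte_fin subr_gt0 ltr_expR ltr_int.
by apply: le_measure; rewrite ?inE//; exact: measurable_cell.
Qed.

Lemma powR_recip (r t : R) : (0 < r)%R -> (0 < t)%R ->
  ((t `^ (- recip r%:E)) `^ r = expR (- ln t))%R.
Proof.
move=> r0 t0; rewrite -powRrM mulNr mulVf ?gt_eqF// powR_inv1 ?ltW//.
by rewrite expRN lnK.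
Qed.

Lemma cell_ln j (t : R) : cell j t -> (j%:~R <= ln t < (j + 1)%:~R)%R.
Proof. by case/cellP => t0 <-; exact: floor_itv. Qed.

Lemma Lq_on_le q : 0 < q -> exists2 C : R, (0 < C)%R & forall D G x,
  (forall j, 0 <= x j) ->
  (forall t, D t -> (0 < t)%R /\ 0 <= G t <=
     (t `^ (- recip q))%:E * x (cell_of t)) ->
  Lq_on q D G <= C%:E * lqnorm q x.
Proof.
case: q => [r| |]// q0; last first.
  exists 1%R => // D G x x0 DG; rewrite mul1e /Lq_on unlock/= muT_gt0.
  apply/ess_supP/nearW => t /=.
  have s0 : 0 <= ereal_sup (range x).
    by apply: (le_trans (x0 0%R)); apply: ereal_sup_ubound; exists 0%R.
  rewrite patchE; case: ifPn => [|_]; last by rewrite abse0.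
  rewrite inE => /DG[t0 /andP[G0 Gt]]; rewrite gee0_abs//; apply: (le_trans Gt).
  rewrite /recip/= invr0 oppr0 powRr0 mul1e.
  by apply: ereal_sup_ubound; exists (cell_of t).
have r0 : (0 < r)%R by rewrite -lte_fin.
have c0 : (0 < expR 1 - 1 :> R)%R by rewrite subr_gt0 -[ltLHS]expR0 ltr_expR.
(* On the cell [j] one has 1/t <= e^(-j), and the length of the cell is e^(j+1) - e^j; the product
   is e - 1. *)
exists ((expR 1 - 1) `^ r^-1)%R; first exact: powR_gt0.
move=> D G x x0 DG; rewrite /Lq_on unlock/=.
rewrite -poweR_EFin -poweRM; last 2 first.
- by rewrite lee_fin ltW.
- by apply: esum_ge0 => j _; exact: poweR_ge0.
apply: ler_poweR; first by rewrite invr_ge0 ltW.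
  by apply: integral_ge0 => t _; exact: poweR_ge0.
pose z j := (expR (- j%:~R))%:E * x j `^ r.
have z0 j : 0 <= z j by rewrite mule_ge0 ?poweR_ge0// lee_fin expR_ge0.
apply: (@le_trans _ _ (\int[mu]_t step z t)).
  apply: integral_mono => t; first exact: poweR_ge0.
  rewrite /= patchE; case: ifPn => [|_]; last first.
    by rewrite abse0 poweR0r ?gt_eqF//; exact: step_ge0.
  rewrite inE => /DG[t0 /andP[G0 Gt]]; rewrite gee0_abs// /step t0.
  apply: (@le_trans _ _
    (((t `^ (- recip r%:E))%:E * x (cell_of t)) `^ r)).
    by apply: ler_poweR => //; exact: ltW.
  rewrite poweRM// ?lee_fin ?powR_ge0// poweR_EFin powR_recip//.
  apply: lee_wpmul2r; first exact: poweR_ge0.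
  by rewrite lee_fin ler_expR lerN2; exact: floor_le.
rewrite integral_step//.
apply: le_trans (esumZ_le _ _ _); last 2 first.
- by rewrite lee_fin ltW.
- by move=> *; exact: poweR_ge0.
apply: le_esum => j _; rewrite /z muleAC -EFinM mulrBr -!expRD rmorphD/=.
by rewrite addNr addrA addNr add0r expR0.
Qed.

(** The alternative [x j = 0] is meant for cells that are not contained in [D], where the truncated
    function gives no lower bound. *)
Lemma le_Lq_on q : 0 < q -> exists2 C : R, (0 < C)%R & forall D G x,
  (forall j, 0 <= x j) ->
  (forall j, x j = 0 \/ forall t, cell j t -> D t /\
     (t `^ (- recip q))%:E * x j <= G t) ->
  lqnorm q x <= C%:E * Lq_on q D G.
Proof.
case: q => [r| |]// q0; last first.
  exists 1%R => // D G x x0 DG; rewrite mul1e.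
  apply: ge_ereal_sup => _ [j _ <-].
  have [->|jG] := DG j; first exact: Lnorm_ge0.
  rewrite /Lq_on unlock/= muT_gt0 leNgt; apply/negP => lt_x.
  have /= [A [mA A0 GA]] := ess_sup_ge mu (abse \o (G \_ D)).
  (* The null set [A] contains all points where the essential supremum is exceeded. If [x j] were
     larger than it, the whole cell would lie in [A], yet a cell has positive measure. *)
  have cA : cell j `<=` A.
    move=> t jt; apply: GA => /= Gs.
    have [Dt] := jG t jt; rewrite /recip/= invr0 oppr0 powRr0 mul1e => xG.
    have := le_lt_trans Gs lt_x; rewrite patchE mem_set// ltNge => /negP; apply.
    by apply: (le_trans xG); exact: lee_abs.
  have : mu (cell j) <= 0.
    by rewrite -A0; apply: le_measure => //; rewrite inE//; exact: measurable_cell.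
  by rewrite cell_measure lee_fin subr_le0 ler_expR ler_int gerDl ler10.
have r0 : (0 < r)%R by rewrite -lte_fin.
(* Now 1/t >= e^(-(j+1)) on the cell [j], and the product with its length is 1 - e^(-1). *)
set c := (1 - expR (- 1) : R)%R.
have c0 : (0 < c)%R by rewrite subr_gt0 -expR0 ltr_expR oppr_lt0.
exists ((c^-1) `^ r^-1)%R; first by rewrite powR_gt0// invr_gt0.
move=> D G x x0 DG; rewrite /Lq_on unlock/=.
have I0 : 0 <= \int[mu]_t `|(G \_ D) t| `^ r.
  by apply: integral_ge0 => t _; exact: poweR_ge0.
rewrite -poweR_EFin -poweRM//; last by rewrite lee_fin invr_ge0 ltW.
apply: ler_poweR; first by rewrite invr_ge0 ltW.
  by apply: esum_ge0 => t _; exact: poweR_ge0.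
pose z j := (expR (- (j + 1)%:~R))%:E * x j `^ r.
have z0 j : 0 <= z j by rewrite mule_ge0 ?poweR_ge0// lee_fin expR_ge0.
apply: (@le_trans _ _ (c^-1%:E * \int[mu]_t step z t)); last first.
  apply: lee_wpmul2l; first by rewrite lee_fin invr_ge0 ltW.
  apply: integral_mono => t; first exact: step_ge0.
  rewrite /step; case: ifPn => t0; last exact: poweR_ge0.
  have tj : cell (cell_of t) t by apply/cellP.
  rewrite /z; have [->|/(_ _ tj)[Dt xG]] := DG (cell_of t).
    by rewrite poweR0r ?gt_eqF// mule0 poweR_ge0.
  apply: (@le_trans _ _
    (((t `^ (- recip r%:E))%:E * x (cell_of t)) `^ r)).
    rewrite poweRM// ?lee_fin ?powR_ge0// poweR_EFin powR_recip//.
    apply: lee_wpmul2r; first exact: poweR_ge0.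
    by rewrite lee_fin ler_expR lerN2 ltW//; have /andP[] := cell_ln tj.
  apply: ler_poweR; [exact: ltW|by rewrite mule_ge0// lee_fin powR_ge0|].
  rewrite patchE mem_set//; apply: (le_trans xG); exact: lee_abs.
rewrite integral_step//.
apply: le_trans (esumZ_le _ _ _); last 2 first.
- by rewrite lee_fin invr_ge0 ltW.
- move=> j; rewrite mule_ge0// lee_fin subr_ge0 ler_expR ler_int.
  by rewrite lerDl.
apply: le_esum => j _; rewrite /z muleAC -EFinM mulrBr -!expRD rmorphD/=.
rewrite addNr expR0 opprD addrAC addNr add0r muleA -EFinM.
by rewrite mulVf ?gt_eqF// mul1e.
Qed.

End lebesgue_norm.

(** * Regularly varying weights *)

Section regular_variation.
Context {R : realType}.
Implicit Types (v w : R -> R) (a b e p x y : R).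

(* In the logarithmic variable [x = ln t]: [w] is [t `^ a] times a slowly
   varying function. *)
Definition rvar a w := (forall x, 0 < w x) /\
  forall e, 0 < e -> exists2 C : R, 0 < C &
  forall x y, w y <= C * expR (a * (y - x) + e * `|y - x|) * w x.

Lemma rvar_exp a : rvar a (fun x => expR (a * x)).
Proof.
split=> [x|e e0]; first exact: expR_gt0.
exists 1 => // x y; rewrite mul1r -expRD ler_expR.
have : 0 <= e * `|y - x| by rewrite mulr_ge0// ltW.
lra.
Qed.

Lemma rvarM a b v w : rvar a v -> rvar b w -> rvar (a + b) (fun x => v x * w x).
Proof.
move=> [v0 hv] [w0 hw]; split=> [x|e e0]; first by rewrite mulr_gt0.
have e2 : 0 < e / 2 by rewrite divr_gt0.
have [C C0 hC] := hv _ e2; have [D D0 hD] := hw _ e2.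
exists (C * D) => [|x y]; first exact: mulr_gt0.
apply: le_trans (ler_pM _ _ (hC x y) (hD x y)) _; try exact: ltW.
rewrite le_eqVlt; apply/orP; left; apply/eqP.
rewrite (_ : (a + b) * (y - x) + e * `|y - x| =
  (a * (y - x) + e / 2 * `|y - x|) + (b * (y - x) + e / 2 * `|y - x|)); last first.
  by field.
by rewrite [in RHS]expRD; ring.
Qed.

Lemma rvarV a w : rvar a w -> rvar (- a) (fun x => (w x)^-1).
Proof.
move=> [w0 hw]; split=> [x|e e0]; first by rewrite invr_gt0.
have [C C0 hC] := hw _ e0; exists C => // x y.
rewrite -[leLHS]mul1r ler_pdivrMr// mulrAC ler_pdivlMr// mul1r.
by apply: le_trans (hC y x) _; rewrite distrC mulNr -mulrN opprB mulrC (mulrC C).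
Qed.

Lemma rvar_powR a w p : 0 < p -> rvar a w -> rvar (a * p) (fun x => w x `^ p).
Proof.
move=> p0 [w0 hw]; split=> [x|e e0]; first exact: powR_gt0.
have [C C0 hC] := hw _ (divr_gt0 e0 p0).
exists (C `^ p) => [|x y]; first exact: powR_gt0.
have E0 u : 0 <= expR u by exact: expR_ge0.
have -> : a * p * (y - x) + e * `|y - x| =
    (a * (y - x) + e / p * `|y - x|) * p.
  by field; rewrite gt_eqF.
rewrite expRM -!powRM ?mulr_ge0 ?(ltW C0) ?(ltW (w0 _))//.
by apply: ge0_ler_powR (hC x y); rewrite ?nnegrE ?mulr_ge0// ltW.
Qed.

(** The function ln v is Lipschitz at large scale: its increments are at most |ln C| + m |y - x|
    with m = |b| + 1. Slow variation of [w] at rate e/m therefore gives rate e for the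
    composition. *)
Lemma rvar_comp b v w : rvar 0 w -> rvar b v -> rvar 0 (fun x => w (ln (v x))).
Proof.
move=> [w0 hw] [v0 hv]; split=> [x|e e0]; first exact: w0.
have [C C0 hC] := hv _ ltr01.
pose m := `|b| + 1; have m0 : 0 < m by rewrite ltr_wpDl.
have vxy x y : ln (v y) - ln (v x) <= `|ln C| + m * `|y - x|.
  have := hC x y; rewrite -ler_ln ?posrE ?mulr_gt0 ?expR_gt0//.
  rewrite !lnM ?posrE ?mulr_gt0 ?expR_gt0// expRK.
  have := ler_norm (ln C); have := ler_norm (b * (y - x)).
  rewrite normrM /m; lra.
have [D D0 hD] := hw _ (divr_gt0 e0 m0).
exists (D * expR (e / m * `|ln C|)) => [|x y].
  by rewrite mulr_gt0// expR_gt0.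
apply: le_trans (hD (ln (v x)) (ln (v y))) _.
rewrite ler_pM2r// !mul0r !add0r -mulrA ler_pM2l// -expRD ler_expR.
apply: (@le_trans _ _ (e / m * (`|ln C| + m * `|y - x|))).
  rewrite ler_pM2l ?divr_gt0// ler_norml vxy andbT.
  by have := vxy y x; rewrite distrC; lra.
rewrite mulrDr lerD2l le_eqVlt; apply/orP; left; apply/eqP.
by field; rewrite gt_eqF.
Qed.

Lemma rvar_near a w m : rvar a w -> exists2 C : R, 0 < C &
  forall x y, `|y - x| <= m -> w y <= C * w x.
Proof.
move=> [w0 hw]; have [C C0 hC] := hw _ ltr01.
exists (C * expR ((`|a| + 1) * m)) => [|x y xym].
  by rewrite mulr_gt0// expR_gt0.
apply: le_trans (hC x y) _; rewrite ler_pM2r// ler_pM2l// ler_expR.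
apply: (@le_trans _ _ ((`|a| + 1) * `|y - x|)).
  by have := ler_norm (a * (y - x)); rewrite normrM; lra.
by rewrite ler_wpM2l// addr_ge0.
Qed.

(** These are Potter's bounds. A move to the right uses that t^(-e) f(t) almost decreases, a move to
    the left that t^e f(t) almost increases; the equivalence is used at both endpoints, hence the
    squared constants. *)
Lemma SV_rvar (f : R -> R) : SV f -> rvar 0 (fun x => f (expR x)).
Proof.
move=> [f0 _ hf]; split=> [x|e e0]; first by apply: f0; exact: expR_gt0.
have [[g [g0 gi [C C0 gC]]] [h [h0 hd [D D0 hD]]]] := hf _ e0.
have E u : expR u `^ e = expR (u * e) by rewrite expRM.
have E' u : expR u `^ (- e) = expR (u * - e) by rewrite expRM.
have P (u : R) : 0 < expR u := expR_gt0 u.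
exists (Num.max (C * C) (D * D)) => [|x y].
  by rewrite lt_max mulr_gt0.
rewrite mul0r add0r; have [xy|/ltW yx] := leP x y.
- have [Dy _] := hD _ (P y); have [_ Dx] := hD _ (P x).
  have := hd (expR x) (expR y) (P x); rewrite ler_expR => /(_ xy) hyx.
  rewrite !E' in Dy Dx.
  rewrite ger0_norm ?subr_ge0//.
  have k : expR (y * - e) * f (expR y) <= D * D * (expR (x * - e) * f (expR x)).
    apply: (le_trans Dy); rewrite -mulrA ler_pM2l//.
    exact: le_trans hyx _.
  apply: (@le_trans _ _ (D * D * expR (e * (y - x)) * f (expR x))).
    rewrite -(ler_pM2l (P (y * - e))); apply: (le_trans k).
    rewrite le_eqVlt; apply/orP; left; apply/eqP.
    rewrite (_ : x * - e = y * - e + e * (y - x)); last by ring.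
    by rewrite expRD; ring.
  apply: ler_wpM2r; first exact/ltW/f0.
  apply: ler_wpM2r; first exact: ltW.
  by rewrite le_max lexx orbT.
- have [Cy _] := gC _ (P y); have [_ Cx] := gC _ (P x).
  have := gi (expR y) (expR x) (P y); rewrite ler_expR => /(_ yx) gyx.
  rewrite !E in Cy Cx.
  rewrite ler0_norm ?subr_le0//.
  have k : expR (y * e) * f (expR y) <= C * C * (expR (x * e) * f (expR x)).
    apply: (le_trans Cy); rewrite -mulrA ler_pM2l//.
    exact: le_trans gyx _.
  apply: (@le_trans _ _ (C * C * expR (e * - (y - x)) * f (expR x))).
    rewrite -(ler_pM2l (P (y * e))); apply: (le_trans k).
    rewrite le_eqVlt; apply/orP; left; apply/eqP.
    rewrite (_ : x * e = y * e + e * - (y - x)); last by ring.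
    by rewrite expRD; ring.
  apply: ler_wpM2r; first exact/ltW/f0.
  apply: ler_wpM2r; first exact: ltW.
  by rewrite le_max lexx.
Qed.

End regular_variation.

(** * Slow variation of tail norms *)

Section tail_norms.
Context {R : realType}.
Local Open Scope ereal_scope.
Implicit Types (q : \bar R) (x y : int -> \bar R) (w b : R -> R).

Lemma lqnorm_shift q x m : 0 < q -> (forall i, 0 <= x i) ->
  lqnorm q (fun i => x (i + m)%R) <= lqnorm q x.
Proof.
case: q => [r| |]//= q0 x0; last first.
  by apply: ereal_sup_le => _ [i _ <-]; exists (i + m)%R.
rewrite [in leRHS](reindex_esum [set: int] _ (fun i => i + m)%R)//.
by split=> // [i j _ _ /addIr//|j _]; exists (j - m)%R => //; rewrite subrK.
Qed.

Definition tail w (j : int) : int -> \bar R :=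
  fun i => if (j <= i)%R then (w i%:~R)%:E else 0.

Lemma tail_ge0 w j i : (forall u, (0 < w u)%R) -> 0 <= tail w j i.
Proof. by move=> w0; rewrite /tail; case: ifP => // _; rewrite lee_fin ltW. Qed.

(** Translation by k - j maps the longer tail onto the shorter one, and [w i] is at most C
    e^(e(k-j)) times [w] at the translated index. *)
Lemma tail_shift q w : 0 < q -> rvar 0 w -> forall e, (0 < e)%R ->
  exists2 C : R, (0 < C)%R & forall j k, (j <= k)%R ->
  lqnorm q (tail w j) <= (C * expR (e * (k - j)%:~R))%:E * lqnorm q (tail w k).
Proof.
move=> q0 [w0 hw] e e0; have [C C0 hC] := hw _ e0.
exists C => // j k jk.
have t0 i l : 0 <= tail w l i by exact: tail_ge0.
set c := (C * _)%R.
have c0 : (0 <= c)%R by rewrite mulr_ge0 ?expR_ge0// ltW.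
apply: (@le_trans _ _
  (c%:E * lqnorm q (fun i => tail w k (i + (k - j))%R))); last first.
  by apply: lee_wpmul2l; [rewrite lee_fin|exact: lqnorm_shift].
apply: le_trans (lqnormZ_le _ _ _) => //.
apply: le_lqnorm => // i; rewrite /tail.
have -> : (k <= i + (k - j))%R = (j <= i)%R by lia.
case: ifP => _; last by rewrite mule0.
rewrite -EFinM lee_fin; apply: le_trans (hC (i + (k - j))%:~R i%:~R) _.
rewrite mul0r add0r rmorphD/= opprD addNKr normrN ger0_norm// ler0z.
by rewrite subr_ge0.
Qed.

Lemma cell_of_le (s t : R) : (0 < s)%R -> (s <= t)%R ->
  (cell_of s <= cell_of t)%R.
Proof. by move=> s0 st; apply: le_floor; rewrite ler_ln ?posrE ?(lt_le_trans s0). Qed.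

Lemma cell_of_near (t : R) : (`|ln t - (cell_of t)%:~R| <= 1)%R.
Proof.
have /andP[a b] := floor_itv (ln t); rewrite /cell_of.
rewrite ger0_norm ?subr_ge0// lerBlDl -[X in (_ <= _ + X)%R](mulr1z 1%R) -rmorphD/=.
exact: ltW.
Qed.

(** The cell that contains [t] may reach below [t], so only the cells from the next one on are sure
    to lie in the interval; this is the shift by 1 in the lower bound. *)
Lemma tail_norm_cell q b : 0 < q -> rvar 0 (fun u => b (expR u)) ->
  exists2 C : R, (0 < C)%R & forall t, (0 < t)%R ->
  tail_norm q b t <= C%:E * lqnorm q (tail (fun u => b (expR u)) (cell_of t)) /\
  lqnorm q (tail (fun u => b (expR u)) (cell_of t + 1)%R) <=
    C%:E * tail_norm q b t.
Proof.
move=> q0 rb; set w := fun u => b (expR u) in rb *.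
have w0 : forall u, (0 < w u)%R := rb.1.
have [C C0 hC] := rvar_near 1%R rb.
have [K K0 hK] := Lq_on_le q0; have [L L0 hL] := le_Lq_on q0.
exists (K * C + L * C)%R; first by rewrite addr_gt0// mulr_gt0.
move=> t t0; split.
  apply: (@le_trans _ _ ((K * C)%:E * lqnorm q (tail w (cell_of t)))); last first.
    apply: lee_wpmul2r; first by apply: lqnorm_ge0 => i; exact: tail_ge0.
    by rewrite lee_fin lerDl mulr_ge0// ltW.
  rewrite EFinM -muleA; apply: le_trans (lee_wpmul2l _ (lqnormZ_le _ _ _)) => //;
    [|by rewrite lee_fin ltW|exact: ltW|by move=> i; exact: tail_ge0].
  apply: hK => [j|s].
    by rewrite mule_ge0 ?tail_ge0// lee_fin ltW.
  rewrite /= in_itv/= andbT => ts; have s0 := lt_trans t0 ts; split=> //.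
  have -> : b s = w (ln s) by rewrite /w lnK.
  rewrite lee_fin mulr_ge0 ?powR_ge0//=; last exact/ltW/w0.
  rewrite /tail (cell_of_le t0 (ltW ts)) -!EFinM lee_fin.
  apply: ler_wpM2l; first exact: powR_ge0.
  by apply: hC; exact: cell_of_near.
apply: (@le_trans _ _ ((L * C)%:E * tail_norm q b t)); last first.
  apply: lee_wpmul2r; first exact: Lnorm_ge0.
  by rewrite lee_fin lerDr mulr_ge0// ltW.
rewrite (lqnorm_scale q0 C0); last by move=> i; exact: tail_ge0.
rewrite mulrC EFinM -muleA; apply: lee_wpmul2l; first by rewrite lee_fin ltW.
apply: hL => [j|j].
  by rewrite mule_ge0 ?tail_ge0// lee_fin invr_ge0 ltW.
rewrite /tail; case: ifPn => tj; last by left; rewrite mule0.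
right=> s sj; have /cellP[s0 sE] := sj; split.
  rewrite /= in_itv/= andbT ltNge; apply/negP => st.
  by have := cell_of_le s0 st; rewrite sE; lia.
rewrite -!EFinM lee_fin; apply: ler_wpM2l; first exact: powR_ge0.
have -> : b s = w (ln s) by rewrite /w lnK.
rewrite ler_pdivrMl//.
by apply: hC; rewrite distrC -sE; exact: cell_of_near.
Qed.

(** Finiteness at one point spreads to lower starting indices by [tail_shift] and to higher ones by
    inclusion of tails. The same two facts give slow variation: moving left costs an arbitrarily
    small exponential, moving right a constant. Positivity holds since a tail dominates its first
    term. *)
Lemma tail_norm_rvar q b : 0 < q -> rvar 0 (fun u => b (expR u)) ->
  tail_norm q b 1 < +oo ->
  let c := fun u => fine (tail_norm q b (expR u)) in
  rvar 0 c /\ exists2 C : R, (0 < C)%R & forall j : int,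
    lqnorm q (tail (fun u => b (expR u)) j) <= (C * c j%:~R)%:E /\
    (c j%:~R)%:E <= C%:E * lqnorm q (tail (fun u => b (expR u)) j).
Proof.
move=> q0 rb b1 c; set w := fun u => b (expR u) in rb *.
have w0 : forall u, (0 < w u)%R := rb.1.
have t0 i l : 0 <= tail w l i by exact: tail_ge0.
have [C C0 hC] := tail_norm_cell q0 rb; rewrite -/w in hC.
have wj j : (w j%:~R)%:E <= lqnorm q (tail w j).
  by apply: le_trans (lqnorm_term j q0 _) => //; rewrite /tail lexx.
have cx (x : R) : cell_of (expR x) = Num.floor x by rewrite /cell_of expRK.
have fin1 : lqnorm q (tail w 1) < +oo.
  have [_] := hC 1%R ltr01; rewrite /cell_of ln1 floor0 add0r => /le_lt_trans; apply.
  by apply: lte_mul_pinfty => //; rewrite lee_fin ltW.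
have fin j : lqnorm q (tail w j) < +oo.
  have [D D0 hD] := tail_shift q0 rb ltr01.
  have [j1|/ltW j1] := leP j 1%R.
    apply: le_lt_trans (hD _ _ j1) _; apply: lte_mul_pinfty => //.
    by rewrite lee_fin mulr_ge0 ?expR_ge0// ltW.
  apply: le_lt_trans fin1; apply: le_lqnorm => // i; rewrite /tail.
  case: ifP => ji; last by case: ifP => // _; rewrite lee_fin ltW.
  by rewrite (le_trans j1 ji).
have cE (x : R) : (c x)%:E = tail_norm q b (expR x).
  rewrite fineK// ge0_fin_numE; last exact: Lnorm_ge0.
  apply: le_lt_trans (hC _ (expR_gt0 x)).1 _.
  by apply: lte_mul_pinfty => //; rewrite lee_fin ltW.
have c0 (x : R) : (0 < c x)%R.
  rewrite -lte_fin cE; have [_ h] := hC _ (expR_gt0 x).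
  rewrite -(@pmule_rgt0 _ C%:E)//.
  by apply: lt_le_trans h; apply: lt_le_trans (wj _); rewrite lte_fin.
have shift e (e0 : (0 < e)%R) : exists2 D : R, (0 < D)%R & forall x y : R,
    (x <= y)%R -> (c x <= D * expR (e * (y - x)) * c y)%R.
  have [D D0 hD] := tail_shift q0 rb e0.
  exists (C * D * expR (2 * e) * C)%R.
    by rewrite !mulr_gt0// expR_gt0.
  move=> x y xy; rewrite -lee_fin cE.
  apply: le_trans (hC _ (expR_gt0 x)).1 _.
  have xy' : (cell_of (expR x) <= cell_of (expR y) + 1)%R.
    have := @cell_of_le (expR x) (expR y) (expR_gt0 x).
    by rewrite ler_expR xy => /(_ isT); lia.
  apply: le_trans (lee_wpmul2l _ (hD _ _ xy')) _; first by rewrite lee_fin ltW.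
  apply: le_trans (lee_wpmul2l _ (lee_wpmul2l _ (hC _ (expR_gt0 y)).2)) _.
  - by rewrite lee_fin ltW.
  - by rewrite lee_fin mulr_ge0 ?expR_ge0// ltW.
  rewrite -cE -!EFinM lee_fin !cx.
  (* Rounding both points and passing to the next cell lengthens y - x by at most 2. *)
  have hE : (expR (e * (Num.floor y + 1 - Num.floor x)%:~R) <=
      expR (2 * e) * expR (e * (y - x)))%R.
    rewrite -expRD ler_expR (mulrC 2%R) -mulrDr ler_pM2l//.
    have /andP[_ +] := floor_itv x; have := floor_le y.
    by rewrite rmorphB/= !rmorphD/=; lra.
  rewrite [leLHS](_ : _ = C * D * C * c y *
    expR (e * (Num.floor y + 1 - Num.floor x)%:~R))%R; last by ring.
  rewrite [leRHS](_ : _ = C * D * C * c y *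
    (expR (2 * e) * expR (e * (y - x))))%R; last by ring.
  by apply: ler_wpM2l => //; rewrite !mulr_ge0// ltW.
have mono : exists2 D : R, (0 < D)%R & forall x y : R, (x <= y)%R ->
    (c y <= D * c x)%R.
  have [D D0 hD] := tail_shift q0 rb ltr01.
  exists (C * D * expR 1 * C)%R; first by rewrite !mulr_gt0// expR_gt0.
  move=> x y xy; rewrite -lee_fin cE.
  apply: le_trans (hC _ (expR_gt0 y)).1 _.
  have xy' : (cell_of (expR x) <= cell_of (expR y))%R.
    by apply: cell_of_le; rewrite ?expR_gt0 ?ler_expR.
  apply: (@le_trans _ _ (C%:E * lqnorm q (tail w (cell_of (expR x))))).
    apply: lee_wpmul2l; first by rewrite lee_fin ltW.
    apply: le_lqnorm => // i; rewrite /tail.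
    case: ifP => ji; last by case: ifP => // _; rewrite lee_fin ltW.
    by rewrite (le_trans xy' ji).
  have h1 : (cell_of (expR x) <= cell_of (expR x) + 1)%R by rewrite lerDl.
  apply: le_trans (lee_wpmul2l _ (hD _ _ h1)) _; first by rewrite lee_fin ltW.
  apply: le_trans (lee_wpmul2l _ (lee_wpmul2l _ (hC _ (expR_gt0 x)).2)) _.
  - by rewrite lee_fin ltW.
  - by rewrite lee_fin mulr_ge0 ?expR_ge0// ltW.
  by rewrite -cE -!EFinM lee_fin addrAC subrr add0r mul1r !mulrA.
split.
  split=> // e e0; have [D D0 hD] := shift e e0; have [M M0 hM] := mono.
  exists (D + M)%R; first exact: addr_gt0.
  move=> x y; rewrite mul0r add0r.
  have E0 : (0 <= expR (e * `|y - x|))%R := expR_ge0 _.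
  have [xy|/ltW yx] := leP x y.
    apply: le_trans (hM _ _ xy) _; apply: ler_wpM2r; first exact: ltW.
    apply: (@le_trans _ _ (M * expR (e * `|y - x|)))%R.
      rewrite ler_peMr ?(ltW M0)// -[leLHS]expR0 ler_expR.
      by rewrite mulr_ge0// ltW.
    by apply: ler_wpM2r => //; rewrite lerDr ltW.
  apply: le_trans (hD _ _ yx) _; apply: ler_wpM2r; first exact: ltW.
  rewrite distrC ger0_norm ?subr_ge0//.
  by apply: ler_wpM2r; rewrite ?expR_ge0// lerDl ltW.
have [D D0 hD] := tail_shift q0 rb ltr01.
exists (D * expR 1 * C + C)%R.
  by rewrite addr_gt0// !mulr_gt0// expR_gt0.
move=> j; have [h1 h2] := hC _ (expR_gt0 j%:~R).
rewrite cx intrKfloor -cE in h1 h2; split.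
  have j1 : (j <= j + 1)%R by rewrite lerDl.
  apply: le_trans (hD _ _ j1) _.
  apply: le_trans (lee_wpmul2l _ h2) _.
    by rewrite lee_fin mulr_ge0 ?expR_ge0// ltW.
  rewrite -!EFinM lee_fin addrAC subrr add0r mul1r mulrA.
  by rewrite ler_wpM2r ?(ltW (c0 _))// lerDl ltW.
apply: le_trans h1 _; apply: lee_wpmul2r; first exact: lqnorm_ge0.
by rewrite lee_fin lerDr !mulr_ge0 ?expR_ge0// ltW.
Qed.

End tail_norms.

(** * The K-functional *)

(** Here [fx], [fy] stand for the K-functional of f at two points, [g], [h] for those of the two
    pieces at the second point, and [e] for the ratio of the points. The first two bounds on [g],
    [h] come from near optimality, the last two from the quasi-triangle inequality. Inserting the
    former into the latter gives fy + 2 fy, hence 3 C; the summand 2 covers the direct bounds. *)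
Lemma split_bounds (R : realFieldType) (C e fx fy g h : R) :
  0 < C -> 0 < e -> 0 <= fx -> 0 <= fy -> g <= 2 * fx -> h <= e * (2 * fx) ->
  g <= C * (fy + h) -> h <= C * (fy + g) ->
  [/\ e * fx <= fy -> g <= (2 + 3 * C) * fy, h <= (2 + 3 * C) * (e * fx),
      g <= (2 + 3 * C) * fx & fx <= fy -> h <= (2 + 3 * C) * fy].
Proof.
move=> C0 e0 fx0 fy0 g1 h1 g2 h2.
have C3 : 2 <= 2 + 3 * C by rewrite lerDl mulr_ge0// ltW.
have key z : z <= C * (3 * fy) -> z <= (2 + 3 * C) * fy.
  by move/le_trans; apply; nra.
split.
- by move=> fe; apply/key/(le_trans g2); rewrite ler_pM2l//; lra.
- by rewrite mulrCA in h1; apply: (le_trans h1); rewrite ler_wpM2r// mulr_ge0// ltW.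
- by apply: (le_trans g1); rewrite ler_wpM2r.
- by move=> ff; apply/key/(le_trans h2); rewrite ler_pM2l//; lra.
Qed.

Section K_functional.
Context (R : realType) (k : scalar_kind).
Context (V : topologicalLmodType (scalar_field R k)).
Implicit Types (X : qspace V) (f g h : V) (s t : R).
Local Open Scope ereal_scope.

(** Monotonicity and scaling of the K-functional rest on this property, which is immediate for the
    outer couple because its norms are Lebesgue norms. *)
Definition nneg_qnorm X := forall f, carrier X f -> 0 <= qnorm X f.

Lemma Kfun_ge0 X0 X1 t f : nneg_qnorm X0 -> nneg_qnorm X1 -> (0 < t)%R ->
  0 <= Kfun X0 X1 t f.
Proof.
move=> n0 n1 t0; apply: le_ereal_inf_tmp => _ [f0 [f1 [c0 c1 _ ->]]].
by rewrite adde_ge0 ?mule_ge0 ?n0 ?n1// lee_fin ltW.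
Qed.

Lemma Kfun_le X0 X1 t f0 f1 : carrier X0 f0 -> carrier X1 f1 ->
  Kfun X0 X1 t (f0 + f1)%R <= qnorm X0 f0 + t%:E * qnorm X1 f1.
Proof. by move=> c0 c1; apply: ereal_inf_lbound; exists f0, f1. Qed.

Lemma Kfun_mono X0 X1 s t f : nneg_qnorm X1 -> (s <= t)%R ->
  Kfun X0 X1 s f <= Kfun X0 X1 t f.
Proof.
move=> n1 st; apply: le_ereal_inf_tmp => _ [f0 [f1 [c0 c1 -> ->]]].
apply: (le_trans (Kfun_le s c0 c1)); apply: leeD => //.
by apply: lee_wpmul2r; [exact: n1|rewrite lee_fin].
Qed.

Lemma Kfun_scale X0 X1 s t f : nneg_qnorm X0 -> nneg_qnorm X1 ->
  (0 < s)%R -> (s <= t)%R ->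
  Kfun X0 X1 t f <= (t / s)%:E * Kfun X0 X1 s f.
Proof.
move=> n0 n1 s0 st; have t0 := lt_le_trans s0 st.
have ts0 : (0 < t / s)%R by rewrite divr_gt0.
rewrite -lee_pdivrMl//; apply: le_ereal_inf_tmp => _ [f0 [f1 [c0 c1 -> ->]]].
rewrite lee_pdivrMl//; apply: (le_trans (Kfun_le t c0 c1)).
have p1 : 0 <= s%:E * qnorm X1 f1 by rewrite mule_ge0 ?n1// lee_fin ltW.
rewrite ge0_muleDr ?n0//; apply: leeD.
  rewrite -[leLHS]mul1e; apply: lee_wpmul2r; first exact: n0.
  by rewrite lee_fin ler_pdivlMr// mul1r.
by rewrite muleA -EFinM divfK// gt_eqF.
Qed.

Definition qlinear X := linear_subspace (carrier X) /\ quasi_norm X.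

Lemma qlinear_nneg X : qlinear X -> nneg_qnorm X.
Proof. by case=> _ [n _ _ _] f /n/andP[]. Qed.

Lemma qlinear_fin X f : qlinear X -> carrier X f -> qnorm X f \is a fin_num.
Proof. by case=> _ [n _ _ _] /n/andP[a b]; rewrite ge0_fin_numE. Qed.

Lemma modulusN1 : modulus (-1 : scalar_field R k) = 1%R.
Proof.
case: k; rewrite /modulus; first exact: (@normrN1 R).
by have -> : (`|-1 : scalar_field R complex_scalars| = 1 :> R[i])%R
  by exact: (@normrN1 R[i]).
Qed.

Lemma modulus0 : modulus (0 : scalar_field R k) = 0%R.
Proof.
case: k; rewrite /modulus; first exact: (@normr0 _ R).
by have -> : (`|0 : scalar_field R complex_scalars| = 0 :> R[i])%R
  by exact: (@normr0 _ R[i]).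
Qed.

Lemma qlinear0 X : qlinear X -> carrier X 0%R /\ qnorm X 0%R = 0.
Proof.
move=> [[X0 _ _] [_ _ h _]]; split=> //.
by rewrite -(scale0r (0 : V)%R) h// modulus0 mul0e.
Qed.

Lemma qlinearN X f : qlinear X -> carrier X f ->
  carrier X (- f)%R /\ qnorm X (- f)%R = qnorm X f.
Proof.
move=> [[_ _ hZ] [_ _ h _]] cf; rewrite -scaleN1r; split; first exact: hZ.
by rewrite h// modulusN1 mul1e.
Qed.

Lemma KfunN X0 X1 t f : qlinear X0 -> qlinear X1 ->
  Kfun X0 X1 t (- f)%R = Kfun X0 X1 t f.
Proof.
move=> q0 q1.
have le g : Kfun X0 X1 t (- g)%R <= Kfun X0 X1 t g.
  apply: le_ereal_inf_tmp => _ [f0 [f1 [c0 c1 -> ->]]].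
  have [c0' <-] := qlinearN q0 c0; have [c1' <-] := qlinearN q1 c1.
  by rewrite opprD; exact: Kfun_le.
by apply/eqP; rewrite eq_le le -{1}(opprK f) le.
Qed.

Lemma Kfun_fin X0 X1 t f : qlinear X0 -> qlinear X1 -> (0 < t)%R ->
  sum_space X0 X1 f -> Kfun X0 X1 t f \is a fin_num.
Proof.
move=> q0 q1 t0 [f0 [f1 [c0 c1 ->]]].
rewrite ge0_fin_numE; last by apply: Kfun_ge0 => //; exact: qlinear_nneg.
apply: (le_lt_trans (Kfun_le t c0 c1)).
have := qlinear_fin q0 c0; have := qlinear_fin q1 c1.
by move=> /fineK <- /fineK <-; rewrite -EFinM -EFinD ltry.
Qed.

Lemma Kfun_near X0 X1 t f (M : \bar R) : Kfun X0 X1 t f < M ->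
  exists f0 f1, [/\ carrier X0 f0, carrier X1 f1, f = (f0 + f1)%R &
    qnorm X0 f0 + t%:E * qnorm X1 f1 < M].
Proof.
by move=> /ereal_inf_lt[_ [f0 [f1 [c0 c1 fE ->]]] lt]; exists f0, f1.
Qed.

Lemma sum_spaceD X0 X1 f g : qlinear X0 -> qlinear X1 ->
  sum_space X0 X1 f -> sum_space X0 X1 g -> sum_space X0 X1 (f + g)%R.
Proof.
move=> [[_ a0 _] _] [[_ a1 _] _].
move=> [f0 [f1 [c0 c1 ->]]] [g0 [g1 [d0 d1 ->]]].
by exists (f0 + g0)%R, (f1 + g1)%R; split; [exact: a0|exact: a1|rewrite addrACA].
Qed.

Lemma sum_spaceN X0 X1 f : qlinear X0 -> qlinear X1 ->
  sum_space X0 X1 f -> sum_space X0 X1 (- f)%R.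
Proof.
move=> q0 q1 [f0 [f1 [c0 c1 ->]]]; exists (- f0)%R, (- f1)%R.
have [? _] := qlinearN q0 c0; have [? _] := qlinearN q1 c1.
by rewrite opprD.
Qed.

Lemma KfunD X0 X1 : qlinear X0 -> qlinear X1 -> exists2 C : R, (0 < C)%R &
  forall t f g, (0 < t)%R -> sum_space X0 X1 f -> sum_space X0 X1 g ->
  Kfun X0 X1 t (f + g)%R <= C%:E * (Kfun X0 X1 t f + Kfun X0 X1 t g).
Proof.
move=> q0 q1; have n0 := qlinear_nneg q0; have n1 := qlinear_nneg q1.
have [[_ a0 _] [_ _ _ [C0 C01 h0]]] := q0.
have [[_ a1 _] [_ _ _ [C1 C11 h1]]] := q1.
pose C := Num.max C0 C1.
have Cp : (0 < C)%R by rewrite lt_max (lt_le_trans ltr01).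
exists C => // t f g t0 sf sg.
rewrite -lee_pdivrMl//; apply/lee_addgt0Pr => e e0.
rewrite lee_pdivrMl//.
have e2 : (0 < e / 2)%R by rewrite divr_gt0.
have Kf := Kfun_fin q0 q1 t0 sf; have Kg := Kfun_fin q0 q1 t0 sg.
have lt (z : \bar R) : z \is a fin_num -> z < z + (e / 2)%:E.
  by move=> zf; rewrite lteDl// lte_fin.
have [f0 [f1 [c0 c1 fE fK]]] := Kfun_near (lt _ Kf).
have [g0 [g1 [d0 d1 gE gK]]] := Kfun_near (lt _ Kg).
have -> : (f + g = (f0 + g0) + (f1 + g1))%R by rewrite fE gE addrACA.
apply: (le_trans (Kfun_le t (a0 _ _ c0 d0) (a1 _ _ c1 d1))).
have l0 : qnorm X0 (f0 + g0)%R <= C%:E * (qnorm X0 f0 + qnorm X0 g0).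
  apply: le_trans (h0 _ _ c0 d0) _; apply: lee_wpmul2r.
    by rewrite adde_ge0 ?n0.
  by rewrite lee_fin le_max lexx.
have l1 : qnorm X1 (f1 + g1)%R <= C%:E * (qnorm X1 f1 + qnorm X1 g1).
  apply: le_trans (h1 _ _ c1 d1) _; apply: lee_wpmul2r.
    by rewrite adde_ge0 ?n1.
  by rewrite lee_fin le_max lexx orbT.
apply: le_trans (leeD l0 (lee_wpmul2l _ l1)) _; first by rewrite lee_fin ltW.
have := leeD (ltW fK) (ltW gK).
have := fineK (qlinear_fin q0 c0); have := fineK (qlinear_fin q1 c1).
have := fineK (qlinear_fin q0 d0); have := fineK (qlinear_fin q1 d1).
move=> <- <- <- <-; rewrite -(fineK Kf) -(fineK Kg) -!(EFinD, EFinM).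
rewrite !lee_fin => h.
rewrite [leLHS](_ : _ = C * ((fine (qnorm X0 f0) + t * fine (qnorm X1 f1)) +
  (fine (qnorm X0 g0) + t * fine (qnorm X1 g1))))%R; last by ring.
by rewrite ler_pM2l//; lra.
Qed.

Section real_valued.
Context (X0 X1 : qspace V).
Hypotheses (q0 : qlinear X0) (q1 : qlinear X1).
Local Close Scope ereal_scope.

Definition logK f (x : R) : R := fine (Kfun X0 X1 (expR x) f).
Local Notation S := (sum_space X0 X1).

Lemma logKE f x : S f -> (logK f x)%:E = Kfun X0 X1 (expR x) f.
Proof. by move=> sf; rewrite fineK// Kfun_fin// expR_gt0. Qed.

Lemma logK_ge0 f x : 0 <= logK f x.
Proof.
by apply: fine_ge0; apply: Kfun_ge0; rewrite ?expR_gt0//; exact: qlinear_nneg.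
Qed.

Lemma logK_mono f x y : S f -> x <= y -> logK f x <= logK f y.
Proof.
move=> sf xy; rewrite -lee_fin !logKE//; apply: Kfun_mono.
  exact: qlinear_nneg.
by rewrite ler_expR.
Qed.

Lemma logK_scale f x y : S f -> x <= y -> logK f y <= expR (y - x) * logK f x.
Proof.
move=> sf xy; rewrite -lee_fin EFinM !logKE// expRB.
apply: Kfun_scale; rewrite ?expR_gt0 ?ler_expR//; exact: qlinear_nneg.
Qed.

Lemma logKN f x : logK (- f) x = logK f x.
Proof. by rewrite /logK KfunN. Qed.

Lemma logKD : exists2 C : R, 0 < C & forall f g x, S f -> S g ->
  logK (f + g) x <= C * (logK f x + logK g x).
Proof.
have [C C0 hC] := KfunD q0 q1; exists C => // f g x sf sg.
rewrite -lee_fin EFinM EFinD !logKE//; last exact: sum_spaceD.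
by apply: hC => //; exact: expR_gt0.
Qed.

Lemma sum_spacel f : carrier X0 f -> S f.
Proof.
by move=> cf; have [c1 _] := qlinear0 q1; exists f, 0; rewrite addr0.
Qed.

Lemma sum_spacer f : carrier X1 f -> S f.
Proof.
by move=> cf; have [c0 _] := qlinear0 q0; exists 0, f; rewrite add0r.
Qed.

Lemma logK0 x : logK 0 x = 0.
Proof.
have [c0 z0] := qlinear0 q0; have [c1 z1] := qlinear0 q1.
apply/eqP; rewrite eq_le logK_ge0 andbT -lee_fin logKE; last exact: sum_spacel.
by have := Kfun_le (expR x) c0 c1; rewrite addr0 z0 z1 mule0 adde0.
Qed.

Lemma logK_eq0 f x y : S f -> logK f x = 0 -> logK f y = 0.
Proof.
move=> sf fx; apply/eqP; rewrite eq_le logK_ge0 andbT.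
have [xy|/ltW yx] := leP x y.
  by apply: le_trans (logK_scale sf xy) _; rewrite fx mulr0.
by rewrite -fx; exact: logK_mono.
Qed.

(** The near-optimal splitting at [x]. Since g lies in the first space its K-functional is at most
    its norm there, and that of h is at most linear in e^y; on the other side of [x] each piece is f
    minus the other one, so the K-functional of f takes over. *)
Lemma logK_decomposition : exists2 C : R, 0 < C & forall f x, S f ->
  exists g h, [/\ S g, S h, f = g + h &
    forall y, (logK g y <= C * logK f (Num.min x y)) /\
     (logK h y <= C * (if y <= x then expR (y - x) * logK f x else logK f y))].
Proof.
have [C C0 hC] := logKD; exists (2 + 3 * C).
  by rewrite addr_gt0// mulr_gt0.
move=> f x sf.
(* If the infimum is 0, twice its value does not exceed it and yields no near-minimiser; but then
   the K-functional of f vanishes everywhere and f = f + 0 will do. *)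
have [fx|fxn0] := eqVneq (logK f x) 0.
  exists f, 0; have s0 := sum_spacel (qlinear0 q0).1.
  rewrite addr0; split=> // y.
  by rewrite !(logK_eq0 _ sf fx) logK0 !mulr0 if_same mulr0.
have fx : 0 < logK f x by rewrite lt0r fxn0 logK_ge0.
have : (Kfun X0 X1 (expR x) f < (2 * logK f x)%:E)%E.
  by rewrite -logKE// lte_fin ltr_pMl// ltr1n.
move=> /Kfun_near[g [h [cg ch fE]]].
have sg := sum_spacel cg; have sh := sum_spacer ch.
have n0 := fine_ge0 (qlinear_nneg q0 cg).
have n1 := fine_ge0 (qlinear_nneg q1 ch).
rewrite -(fineK (qlinear_fin q0 cg)) -(fineK (qlinear_fin q1 ch)).
rewrite -EFinM -EFinD lte_fin => /ltW le.
have gl y : logK g y <= 2 * logK f x.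
  apply: (@le_trans _ _ (fine (qnorm X0 g))).
    rewrite -lee_fin logKE// fineK ?qlinear_fin//.
    have [c1 z1] := qlinear0 q1; have := Kfun_le (expR y) cg c1.
    by rewrite addr0 z1 mule0 adde0.
  by apply: le_trans le; rewrite lerDl mulr_ge0// expR_ge0.
have hl y : logK h y <= expR (y - x) * (2 * logK f x).
  apply: (@le_trans _ _ (expR y * fine (qnorm X1 h))).
    rewrite -lee_fin logKE// EFinM fineK ?qlinear_fin//.
    have [c0 z0] := qlinear0 q0; have := Kfun_le (expR y) c0 ch.
    by rewrite add0r z0 add0e.
  rewrite (_ : expR y = expR (y - x) * expR x); last by rewrite -expRD subrK.
  rewrite -mulrA ler_wpM2l ?expR_ge0//.
  by apply: le_trans le; rewrite lerDr.
have g_le y : logK g y <= C * (logK f y + logK h y).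
  have -> : g = f + - h by rewrite fE addrK.
  by rewrite -(logKN h); apply: hC => //; exact: sum_spaceN.
have h_le y : logK h y <= C * (logK f y + logK g y).
  have -> : h = f + - g by rewrite fE addrAC subrr add0r.
  by rewrite -(logKN g); apply: hC => //; exact: sum_spaceN.
exists g, h; split; [exact: sg|exact: sh|exact: fE|] => y.
have [b1 b2 b3 b4] := split_bounds C0 (expR_gt0 (y - x)) (ltW fx)
  (logK_ge0 f y) (gl y) (hl y) (g_le y) (h_le y).
have [yx|/ltW xy] := leP y x; split; last first.
- by apply: b4; exact: (logK_mono sf xy).
- exact: b3.
- exact: b2.
apply: b1; have := logK_scale sf yx.
by rewrite -opprB expRN ler_pdivlMl// expR_gt0.
Qed.

End real_valued.
End K_functional.

(** * Hardy inequalities *)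

Section rvar_monotone.
Context {R : realType}.
Implicit Types (w : R -> R) (a m : R).

Lemma rvar_decr a w m : rvar a w -> m < - a -> exists2 C : R, 0 < C &
  forall x y, x <= y -> w y <= C * expR (- (m * (y - x))) * w x.
Proof.
move=> [w0 hw] ma; have e0 : 0 < - a - m by rewrite subr_gt0.
have [C C0 hC] := hw _ e0; exists C => // x y xy.
have := hC x y; rewrite ger0_norm ?subr_ge0//.
by rewrite (_ : a * (y - x) + _ = - (m * (y - x))); last by ring.
Qed.

Lemma rvar_incr a w m : rvar a w -> m < a -> exists2 C : R, 0 < C &
  forall x y, x <= y -> w x <= C * expR (- (m * (y - x))) * w y.
Proof.
move=> [w0 hw] ma; have e0 : 0 < a - m by rewrite subr_gt0.
have [C C0 hC] := hw _ e0; exists C => // x y xy.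
have := hC y x; rewrite distrC ger0_norm ?subr_ge0//.
by rewrite (_ : a * (x - y) + _ = - (m * (y - x))); last by ring.
Qed.

End rvar_monotone.

Section decay_theory.
Context {R : realType}.
Implicit Types (i j l : int) (m s : R).

Lemma decay_le1 s j l : 0 <= s -> decay s j l <= 1.
Proof. by move=> s0; rewrite -expR0 ler_expR oppr_le0 mulr_ge0. Qed.

Lemma decayD s m j l : decay (s + m) j l = decay s j l * decay m j l.
Proof. by rewrite /decay -expRD -opprD mulrDl. Qed.

Lemma decayxx s j : decay s j j = 1.
Proof. by rewrite /decay subrr normr0 mulr0 oppr0 expR0. Qed.

Lemma decay_ler s j l : l <= j -> decay s j l = expR (- (s * (j%:~R - l%:~R))).
Proof. by move=> lj; rewrite /decay ger0_norm// subr_ge0 ler_int. Qed.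

Lemma decay_lel s j l : j <= l -> decay s j l = expR (- (s * (l%:~R - j%:~R))).
Proof. by move=> lj; rewrite decay_sym decay_ler. Qed.

End decay_theory.

Section hardy.
Context {R : realType}.
Variables (r0 r1 q1 : \bar R) (th1 alpha beta : R) (B E A c d W rho : R -> R).
Hypotheses (r0_gt0 : (0 < r0)%E) (r1_gt0 : (0 < r1)%E) (q1_gt0 : (0 < q1)%E).
Hypotheses (th1_lt1 : th1 < 1) (alpha_gt0 : 0 < alpha) (beta_gt0 : 0 < beta).
Hypotheses (B_gt0 : forall x, 0 < B x) (E_gt0 : forall x, 0 < E x).
Hypotheses (rA : rvar 0 A) (rc : rvar 0 c) (rd : rvar 0 d).
Hypotheses (rW : rvar (- alpha) W) (rV : rvar beta (fun x => W x * rho x)).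
Hypothesis rhoE : forall x, rho x = expR (th1 * x) * (c x / (A x * d x)).
Hypothesis tailB : exists2 C : R, 0 < C & forall j : int,
  (lqnorm r0 (tail B j) <= (C * c j%:~R)%:E)%E.
Hypothesis tailE : exists2 C : R, 0 < C & forall j : int,
  (lqnorm r1 (tail E j) <= (C * d j%:~R)%:E)%E.

Let A0 : forall x, 0 < A x := rA.1.
Let c0 : forall x, 0 < c x := rc.1.
Let d0 : forall x, 0 < d x := rd.1.
Let W0 : forall x, 0 < W x := rW.1.

(** For i >= j the function phi is frozen at j and the weights [B] sum up to [c j]. For i < j the
    decrease of [W] yields e^(-2 dlt (j-i)), as 2 dlt < alpha: one half is absorbed by the
    hypothesis on [s], the other half makes the sum over i converge. *)
Lemma hardy_head : exists2 dlt : R, 0 < dlt & exists2 C : R, 0 < C &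
  forall (phi : R -> R) (j : int) (s : R), (forall x, 0 <= phi x) ->
  (forall l : int, decay dlt l j * (W l%:~R * c l%:~R * phi l%:~R) <= s) ->
  (lqnorm r0 (fun i : int => (W j%:~R * (B i%:~R *
     phi (Num.min (j%:~R : R) i%:~R)))%:E) <= (C * s)%:E)%E.
Proof.
pose dlt := alpha / 4; have dlt0 : 0 < dlt by rewrite divr_gt0.
exists dlt => //.
have [CW CW0 hW] : exists2 C : R, 0 < C &
    forall x y, x <= y -> W y <= C * expR (- ((dlt + dlt) * (y - x))) * W x.
  apply: (rvar_decr rW); rewrite opprK /dlt.
  by have := alpha_gt0; lra.
have [CB CB0 hB] := tailB.
have BC j : B j%:~R <= CB * c j%:~R.
  rewrite -lee_fin; apply: le_trans (hB j).
  apply: le_trans (lqnorm_term j r0_gt0 _); first by rewrite /tail lexx.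
  by move=> i; exact: tail_ge0.
have [M M0 hM] := lqnorm_decay r0_gt0 dlt0.
have [K K0 hK] := lqnormD r0_gt0.
exists ((CW * CB + 1) * (K * (M + CB))).
  by rewrite !mulr_gt0 ?addr_gt0// mulr_gt0.
move=> phi j s phi0 hs.
have s0 : 0 <= s.
  apply: le_trans (hs j); rewrite !mulr_ge0// ltW//; exact: decay_gt0.
(* A majorant of both ranges at once: the decay serves i < j, the normalised tail serves i >= j. *)
pose x i := ((decay dlt i j)%:E + (c j%:~R)^-1%:E * tail B j i)%E.
have t0 i l : (0 <= tail B l i)%E by exact: tail_ge0.
have D0 i l : (0 <= (decay dlt i l)%:E)%E by rewrite lee_fin ltW// decay_gt0.
have ci0 : 0 <= (c j%:~R)^-1 by rewrite invr_ge0 ltW.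
have x0 i : (0 <= x i)%E by rewrite adde_ge0// mule_ge0// lee_fin.
have C1 : 0 < CW * CB + 1 by rewrite addr_gt0 ?mulr_gt0.
apply: (@le_trans _ _ (lqnorm r0 (fun i => ((CW * CB + 1) * s)%:E * x i)%E)).
  apply: le_lqnorm => // i.
    by rewrite lee_fin !mulr_ge0// ltW.
  rewrite /x /tail; have [ij|ji] := leP j i.
    rewrite min_l ?ler_int//= -!(EFinM, EFinD) lee_fin.
    apply: (@le_trans _ _ (s * (B i%:~R / c j%:~R))).
      have := hs j; rewrite decayxx mul1r => hj.
      rewrite [leLHS](_ : _ =
        W j%:~R * c j%:~R * phi j%:~R * (B i%:~R / c j%:~R)); last first.
        by field; rewrite gt_eqF.
      by rewrite ler_wpM2r// divr_ge0// ltW.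
    rewrite (mulrC (CW * CB + 1)) -mulrA ler_wpM2l//.
    rewrite mulrC -[leLHS]mul1r ler_pM//.
      by rewrite mulr_ge0// ltW.
      by rewrite lerDr mulr_ge0 ?ltW.
    by rewrite lerDr ltW// decay_gt0.
  rewrite /= mule0 adde0 -EFinM lee_fin min_r ?ler_int ?(ltW ji)//.
  have ij : (i%:~R : R) <= j%:~R by rewrite ler_int ltW.
  apply: (@le_trans _ _
    ((CW * decay (dlt + dlt) i j * W i%:~R) * (CB * c i%:~R * phi i%:~R))).
    rewrite ler_pM ?(mulr_ge0 (ltW (B_gt0 _)))//; first exact: ltW.
      by rewrite decay_lel ?(ltW ji)//; apply: hW.
    by rewrite ler_wpM2r.
  rewrite decayD [leLHS](_ : _ = CW * CB * (decay dlt i j *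
    (W i%:~R * c i%:~R * phi i%:~R)) * decay dlt i j); last by ring.
  rewrite ler_wpM2r//; first by rewrite ltW// decay_gt0.
  rewrite ler_pM ?mulr_ge0//; try exact: ltW; first exact/ltW/decay_gt0.
  by rewrite lerDl.
apply: le_trans (lqnormZ_le r0_gt0 _ x0) _; first by rewrite mulr_ge0// ltW.
rewrite [in leRHS]mulrAC [leRHS]EFinM; apply: lee_wpmul2l.
  by rewrite lee_fin mulr_ge0// ltW.
apply: le_trans (hK _ _ _ _) _ => //.
  by move=> i; rewrite mule_ge0// lee_fin.
rewrite EFinM; apply: lee_wpmul2l; first by rewrite lee_fin ltW.
rewrite EFinD; apply: leeD; first exact: hM.
apply: le_trans (lqnormZ_le r0_gt0 ci0 _) _ => //.
apply: le_trans (lee_wpmul2l _ (hB j)) _; first by rewrite lee_fin.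
by rewrite -EFinM lee_fin mulrCA mulVf ?mulr1// gt_eqF.
Qed.

(** Two nested norms with unrelated exponents. Decay away from j removes the inner norm, and the
    kernel lemma then sums the outer weights [E] over i >= l, which produces [d l] and cancels the
    denominator of [rho]. *)
Lemma hardy_tail : exists2 dlt : R, 0 < dlt & exists2 C : R, 0 < C &
  forall (phi : R -> R) (j : int) (s : R), (forall x, 0 <= phi x) ->
  (forall l : int, decay dlt l j * (W l%:~R * c l%:~R * phi l%:~R) <= s) ->
  (lqnorm r1 (fun i : int => (W j%:~R * rho j%:~R * E i%:~R)%:E *
     lqnorm q1 (fun l : int => if (l <= i)%R then
       (expR (- (th1 * l%:~R)) * A l%:~R *
         (if (l%:~R : R) <= j%:~R then expR (l%:~R - j%:~R) * phi j%:~R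
          else phi l%:~R))%:E else 0)) <= (C * s)%:E)%E.
Proof.
pose m := Num.min beta (1 - th1).
have m0 : 0 < m by rewrite lt_min beta_gt0 subr_gt0.
have [mb mt] : m <= beta /\ m <= 1 - th1.
  by rewrite /m !ge_min !lexx orbT.
(* For l > j a decay of 3 dlt is taken from beta: one for [s], one for the inner and one for the
   outer norm. For l <= j, 1 - th1 has to yield 2 dlt after the growth dlt of [A] is paid. *)
pose dlt := m / 8; have dlt0 : 0 < dlt by rewrite divr_gt0.
have md : m = 8 * dlt by rewrite /dlt; field.
exists dlt => //.
have [CV CV0 hV] : exists2 C : R, 0 < C & forall x y, x <= y ->
    W x * rho x <= C * expR (- ((dlt + dlt + dlt) * (y - x))) * (W y * rho y).
  by apply: (rvar_incr rV); lra.
have [CA CA0 hA] : exists2 C : R, 0 < C & forall x y, x <= y ->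
    A x <= C * expR (- (- dlt * (y - x))) * A y.
  by apply: (rvar_incr rA); lra.
have [Cd Cd0 hd] : exists2 C : R, 0 < C & forall x y, x <= y ->
    d x <= C * expR (- (- (dlt / 2) * (y - x))) * d y.
  by apply: (rvar_incr rd); rewrite oppr_lt0 divr_gt0.
have [CE CE0 hE] := tailE.
have [M M0 hM] := lqnorm_decay q1_gt0 dlt0.
have dlt20 : 0 < dlt / 2 by rewrite divr_gt0.
have [N N0 hN] := lqnorm_decay r1_gt0 dlt20.
pose K := CV + CA; have K0 : 0 < K by rewrite addr_gt0.
exists (K * M * (CE * (1 + Cd) * N)); first by rewrite !mulr_gt0 ?addr_gt0.
move=> phi j s phi0 hs.
have s0 : 0 <= s.
  apply: le_trans (hs j); rewrite !mulr_ge0// ltW//; exact: decay_gt0.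
(* The share of the bound reserved for the outer norm. The denominator is [d j] for l <= j, coming
   from [rho j], and [d l] for l > j, coming from [rho l] once the weight has been moved to l. *)
pose om l : R := decay dlt l j / d (Num.max (l%:~R : R) j%:~R).
have om0 l : 0 < om l by rewrite divr_gt0// decay_gt0.
pose u l : R := W j%:~R * rho j%:~R * (expR (- (th1 * l%:~R)) * A l%:~R *
  (if (l%:~R : R) <= j%:~R then expR (l%:~R - j%:~R) * phi j%:~R
   else phi l%:~R)).
have Vc x : W x * rho x = W x * c x * expR (th1 * x) / (A x * d x).
  by rewrite rhoE; ring.
have rho0 x : 0 < rho x.
  by rewrite rhoE mulr_gt0 ?expR_gt0// divr_gt0// mulr_gt0.
have u0 l : 0 <= u l.
  rewrite /u !mulr_ge0 ?expR_ge0 ?(ltW (W0 _)) ?(ltW (rho0 _)) ?(ltW (A0 _))//.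
  by case: ifP => _; rewrite ?mulr_ge0 ?expR_ge0.
(* For [l <= j] the factor [expR ((1 - th1) * (l - j))] decays; for [l >= j] the
   growth of [W * rho] does the same job. *)
have ul l : u l <= K * s * decay dlt l j * om l.
  rewrite /u /om ler_int; have [lj|jl] := leP l j.
    have lj' : (l%:~R : R) <= j%:~R by rewrite ler_int.
    rewrite max_r// Vc.
    have hj : W j%:~R * c j%:~R * phi j%:~R <= s.
      by have := hs j; rewrite decayxx mul1r.
    rewrite [leLHS](_ : _ = (W j%:~R * c j%:~R * phi j%:~R / d j%:~R) *
      ((expR (th1 * j%:~R) * expR (- (th1 * l%:~R)) * expR (l%:~R - j%:~R)) *
      (A l%:~R / A j%:~R))); last first.
      by field; rewrite !gt_eqF.
    rewrite [leRHS](_ : _ = (s / d j%:~R) *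
      (K * decay (dlt + dlt) l j)); last by rewrite decayD; ring.
    have e0 : 0 <= expR (th1 * j%:~R) * expR (- (th1 * l%:~R)) *
      expR (l%:~R - j%:~R) by rewrite !mulr_ge0 ?expR_ge0.
    apply: ler_pM.
    - by rewrite !mulr_ge0 ?invr_ge0// ltW.
    - by rewrite mulr_ge0// divr_ge0// ltW.
    - by rewrite ler_wpM2r// invr_ge0 ltW.
    have hAl : A l%:~R / A j%:~R <= CA * expR (dlt * (j%:~R - l%:~R)).
      by rewrite ler_pdivrMr//; have := hA _ _ lj'; rewrite mulNr opprK.
    apply: le_trans (ler_wpM2l e0 hAl) _.
    rewrite mulrCA -!expRD decay_lel//.
    apply: ler_pM; rewrite ?expR_ge0 ?(ltW CA0)//; first by rewrite lerDr ltW.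
    rewrite ler_expR.
    set x := j%:~R - l%:~R; have x0 : 0 <= x by rewrite subr_ge0.
    have -> : th1 * j%:~R + - (th1 * l%:~R) + (l%:~R - j%:~R) + dlt * x =
      - ((1 - th1 - dlt) * x) by rewrite /x; ring.
    by rewrite lerN2 ler_wpM2r//; lra.
  have jl' : (j%:~R : R) <= l%:~R by rewrite ler_int ltW.
  rewrite max_l//.
  have u1 : 0 <= expR (- (th1 * l%:~R)) * A l%:~R * phi l%:~R.
    by rewrite !mulr_ge0 ?expR_ge0// ltW.
  apply: le_trans (ler_wpM2r u1 (hV _ _ jl')) _.
  rewrite Vc [leLHS](_ : _ = CV * expR (- ((dlt + dlt + dlt) * (l%:~R - j%:~R))) *
     (W l%:~R * c l%:~R * phi l%:~R) / d l%:~R *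
     (expR (th1 * l%:~R) * expR (- (th1 * l%:~R)))); last first.
    by field; rewrite !gt_eqF.
  rewrite -expRD subrr expR0 mulr1 -decay_ler ?(ltW jl)// !decayD.
  rewrite [leLHS](_ : _ = (CV * (decay dlt l j *
    (W l%:~R * c l%:~R * phi l%:~R))) *
    (decay dlt l j * decay dlt l j / d l%:~R)); last by ring.
  rewrite [leRHS](_ : _ = (K * s) *
    (decay dlt l j * decay dlt l j / d l%:~R)); last by ring.
  apply: ler_wpM2r.
    by rewrite !mulr_ge0 ?invr_ge0 ?(ltW (decay_gt0 _ _ _))// ltW.
  apply: ler_pM => //; first exact: ltW.
    by rewrite !mulr_ge0 ?(ltW (decay_gt0 _ _ _))// ltW.
  by rewrite lerDl ltW.
have tE0 i l : (0 <= tail E l i)%E by exact: tail_ge0.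
have om0' l : (0 <= (om l)%:E)%E by rewrite lee_fin ltW.
have Ks0 : 0 <= K * s by rewrite mulr_ge0// ltW.
(* The inner norm is at most this supremum times the norm of the remaining decay, which decouples
   [q1] from [r1]. The factor [tail E l i] encodes both the weight [E i] and the restriction l <=
   i. *)
pose Sg i := ereal_sup (range (fun l => tail E l i * (om l)%:E))%E.
have Sg0 i : (0 <= Sg i)%E.
  by apply: le_ereal_sup_tmp; exists (tail E 0 i * (om 0)%:E)%E;
    [exists 0|rewrite mule_ge0].
have inner i : ((W j%:~R * rho j%:~R * E i%:~R)%:E *
     lqnorm q1 (fun l : int => if (l <= i)%R then
       (expR (- (th1 * l%:~R)) * A l%:~R *
         (if (l%:~R : R) <= j%:~R then expR (l%:~R - j%:~R) * phi j%:~R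
          else phi l%:~R))%:E else 0) <= (K * s * M)%:E * Sg i)%E.
  have V0 : 0 < W j%:~R * rho j%:~R * E i%:~R by rewrite !mulr_gt0.
  rewrite -lqnormZ//; last first.
    move=> l; case: ifP => // _; rewrite lee_fin !mulr_ge0 ?expR_ge0//.
      by rewrite ltW.
    by case: ifP => _; rewrite ?mulr_ge0 ?expR_ge0.
  have le1 l : ((W j%:~R * rho j%:~R * E i%:~R)%:E *
      (if (l <= i)%R then (expR (- (th1 * l%:~R)) * A l%:~R *
         (if (l%:~R : R) <= j%:~R then expR (l%:~R - j%:~R) * phi j%:~R
          else phi l%:~R))%:E else 0) <=
      ((K * s)%:E * Sg i) * (decay dlt l j)%:E)%E.
    case: ifPn => li; last first.
      by rewrite mule0 !mule_ge0 ?lee_fin// ltW// decay_gt0.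
    apply: (@le_trans _ _
      ((K * s)%:E * (tail E l i * (om l)%:E) * (decay dlt l j)%:E)%E).
      rewrite /tail li -!EFinM lee_fin.
      rewrite [leLHS](_ : _ = E i%:~R * u l); last by rewrite /u; ring.
      rewrite [leRHS](_ : _ = E i%:~R * (K * s * decay dlt l j * om l));
        last by ring.
      by rewrite ler_wpM2l// ltW.
    apply: lee_wpmul2r; first by rewrite lee_fin ltW// decay_gt0.
    apply: lee_wpmul2l; first by rewrite lee_fin.
    by apply: ereal_sup_ubound; exists l.
  apply: le_trans (le_lqnorm q1_gt0 _ le1) _.
    move=> l; case: ifPn => li; last by rewrite mule0.
    rewrite -EFinM lee_fin [leRHS](_ : _ = E i%:~R * u l); last first.
      by rewrite /u; ring.
    by rewrite mulr_ge0// ltW.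
  apply: le_trans (lqnormZ_lee q1_gt0 _ _) _.
  - by rewrite mule_ge0// lee_fin.
  - by move=> l; rewrite lee_fin ltW// decay_gt0.
  apply: le_trans (lee_wpmul2l _ (hM j)) _.
    by rewrite mule_ge0// lee_fin.
  by rewrite [in leRHS]EFinM -!muleA (muleC (Sg i)).
apply: le_trans (le_lqnorm r1_gt0 _ inner) _.
  move=> i; rewrite mule_ge0 ?lee_fin//; first by rewrite !mulr_ge0// ltW.
  apply: lqnorm_ge0 => l; case: ifP => // _.
  rewrite lee_fin !mulr_ge0 ?expR_ge0//; first by rewrite ltW.
  by case: ifP => _; rewrite ?mulr_ge0 ?expR_ge0.
have KsM0 : 0 <= K * s * M by rewrite mulr_ge0// ltW.
apply: le_trans (lqnormZ_le r1_gt0 KsM0 Sg0) _.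
rewrite (_ : K * M * (CE * (1 + Cd) * N) * s =
  K * s * M * (CE * (1 + Cd) * N)); last by ring.
rewrite [leRHS]EFinM; apply: lee_wpmul2l; first by rewrite lee_fin.
apply: (@le_trans _ _
  (lqnorm r1 (fun l => (CE * d l%:~R)%:E * (om l)%:E)%E)).
  apply: (@lqnorm_kernel _ _ (fun i l => tail E l i)) => //.
apply: (@le_trans _ _
  (lqnorm r1 (fun l => (CE * (1 + Cd))%:E * (decay (dlt / 2) l j)%:E)%E)).
  apply: le_lqnorm => // l; first by rewrite mule_ge0// lee_fin mulr_ge0// ltW.
  rewrite -!EFinM lee_fin -!(mulrA CE) ler_wpM2l ?(ltW CE0)// /om.
  have D0 : 0 < decay (dlt / 2) l j by exact: decay_gt0.
  (* One half of the decay beats the possible growth of d l / d j for l <= j, the other half remains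
     for the final sum over l. *)
  rewrite [in leLHS](_ : dlt = dlt / 2 + dlt / 2); last by field.
  rewrite decayD.
  rewrite [leLHS](_ : _ = decay (dlt / 2) l j * d l%:~R /
    d (Num.max (l%:~R : R) j%:~R) * decay (dlt / 2) l j); last by ring.
  rewrite ler_wpM2r ?(ltW D0)//.
  rewrite ler_pdivrMr//.
  have [lj|jl] := leP l j.
    have lj' : (l%:~R : R) <= j%:~R by rewrite ler_int.
    rewrite max_r//.
    apply: le_trans (ler_wpM2l (ltW D0) (hd _ _ lj')) _.
    rewrite mulNr opprK decay_lel// mulrA mulrCA -expRD addNr expR0 mulr1.
    by rewrite ler_wpM2r ?(ltW (d0 _))// lerDr.
  rewrite max_l ?ler_int ?(ltW jl)// ler_wpM2r ?(ltW (d0 _))//.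
  by apply: le_trans (decay_le1 _ _ (ltW dlt20)) _; rewrite lerDl ltW.
rewrite [in leRHS]EFinM; apply: le_trans (lqnormZ_le r1_gt0 _ _) _.
- by rewrite mulr_ge0 ?addr_ge0// ltW.
- by move=> l; rewrite lee_fin ltW// decay_gt0.
apply: lee_wpmul2l; last exact: hN.
by rewrite lee_fin mulr_ge0 ?addr_ge0// ltW.
Qed.

End hardy.

(** Controls the norm of the numbers [s] of the Hardy inequalities when they are chosen as small as
    possible. By symmetry of the decay the columns of the kernel are uniformly summable. *)
Lemma lqnorm_sup_decay (R : realType) (q : \bar R) (e : R) :
  (0 < q)%E -> 0 < e -> exists2 C : R, 0 < C &
  forall y : int -> \bar R, (forall l, (0 <= y l)%E) ->
  (lqnorm q (fun j => ereal_sup (range (fun l => (decay e l j)%:E * y l))) <=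
    C%:E * lqnorm q y)%E.
Proof.
move=> q0 e0; have [M M0 hM] := lqnorm_decay q0 e0.
exists M => // y y0.
have d0 j l : (0 <= (decay e l j)%:E)%E by rewrite lee_fin ltW// decay_gt0.
apply: le_trans (lqnormZ_le q0 (ltW M0) y0).
apply: (@lqnorm_kernel _ _ (fun j l => (decay e l j)%:E)) => // [j|i].
  by apply: le_ereal_sup_tmp; exists ((decay e 0%R j)%:E * y 0%R)%E;
    [exists 0%R|rewrite mule_ge0].
under eq_lqnorm do rewrite decay_sym; exact: hM.
Qed.

(** * Weighted norms of the K-functional *)

Section weighted_norms.
Context (R : realType) (k : scalar_kind).
Context (V : topologicalLmodType (scalar_field R k)).
Implicit Types (X : qspace V) (f : V) (D : set R) (P : pred int).
Local Open Scope ereal_scope.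

(** The predicate selects cells: all of them for the half-line, those up to [i] for an interval (0,
    t), and a single one for a lower bound. *)
Definition Kseq X0 X1 (sigma : R) (a : R -> R) f P (j : int) : \bar R :=
  if P j then (expR (- (sigma * j%:~R)) * a (expR j%:~R))%:E *
    Kfun X0 X1 (expR j%:~R) f
  else 0.

Variables (X0 X1 : qspace V).
Hypotheses (n0 : nneg_qnorm X0) (n1 : nneg_qnorm X1).

Lemma Kfun_cell t f : (0 < t)%R ->
  Kfun X0 X1 (expR (cell_of t)%:~R) f <= Kfun X0 X1 t f /\
  Kfun X0 X1 t f <= (expR 1)%:E * Kfun X0 X1 (expR (cell_of t)%:~R) f.
Proof.
move=> t0; have : cell (cell_of t) t by apply/cellP.
rewrite /cell/= in_itv/= => /andP[jt tj].
have e0 := expR_gt0 ((cell_of t)%:~R : R).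
split; first exact: Kfun_mono.
apply: (le_trans (Kfun_scale f n0 n1 e0 jt)).
apply: lee_wpmul2r; first exact: Kfun_ge0.
rewrite lee_fin ler_pdivrMr// -expRD; apply: (le_trans (ltW tj)).
by rewrite rmorphD/= addrC.
Qed.

Lemma weight_split q sigma (a : R -> R) (t : R) : (0 < t)%R ->
  (t `^ (- sigma - recip q) * a t =
   t `^ (- recip q) * (expR (- (sigma * ln t)) * a (expR (ln t))))%R.
Proof.
move=> t0; rewrite lnK ?posrE// powRD; last by apply/implyP => _; rewrite gt_eqF.
by rewrite mulrA (mulrC (t `^ (- recip q))%R) {1}/powR gt_eqF// mulNr.
Qed.

Lemma Kseq_ge0 sigma a f P j : (forall x, (0 < a (expR x))%R) ->
  0 <= Kseq X0 X1 sigma a f P j.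
Proof.
move=> a0; rewrite /Kseq; case: ifP => // _.
rewrite mule_ge0 ?Kfun_ge0 ?expR_gt0// lee_fin mulr_ge0 ?expR_ge0//.
exact: ltW.
Qed.

Lemma rvar_weight (sigma : R) (a : R -> R) : rvar 0 (fun x => a (expR x)) ->
  rvar (- sigma) (fun x => expR (- (sigma * x)) * a (expR x))%R.
Proof.
move=> ra; rewrite -[(- sigma)%R]addr0; apply: rvarM => //.
have := rvar_exp (- sigma)%R.
by rewrite (_ : (fun x => _) = (fun x => expR (- (sigma * x))))//;
  apply/funext => x; rewrite mulNr.
Qed.

Lemma weighted_K_norm_le q sigma a : 0 < q -> rvar 0 (fun x => a (expR x)) ->
  exists2 C : R, (0 < C)%R & forall f D P,
  (forall t, D t -> (0 < t)%R /\ P (cell_of t)) ->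
  weighted_K_norm X0 X1 sigma q a D f <=
    C%:E * lqnorm q (Kseq X0 X1 sigma a f P).
Proof.
move=> q0 ra; have [C C0 hC] := rvar_near 1%R (rvar_weight sigma ra).
have [M M0 hM] := Lq_on_le q0; have e0 := expR_gt0 (1%R : R).
have K0 : (0 < C * expR 1)%R by rewrite mulr_gt0.
exists (M * (C * expR 1))%R; first by rewrite mulr_gt0.
move=> f D P DP.
have s0 j : 0 <= Kseq X0 X1 sigma a f P j by apply: Kseq_ge0; exact: ra.1.
rewrite EFinM -muleA -lqnormZ//.
apply: hM => [j|t Dt]; first by rewrite mule_ge0// lee_fin ltW.
have [t0 Pt] := DP _ Dt; split=> //.
have w0 (x : R) : (0 < expR (- (sigma * x)) * a (expR x))%R.
  by rewrite mulr_gt0 ?expR_gt0//; exact: ra.1.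
rewrite weight_split// mule_ge0 ?Kfun_ge0//=; last first.
  by rewrite lee_fin mulr_ge0 ?powR_ge0// ltW.
rewrite EFinM -muleA; apply: lee_wpmul2l; first by rewrite lee_fin powR_ge0.
rewrite /Kseq Pt (EFinM C) muleACA -EFinM.
apply: lee_pmul; rewrite ?Kfun_ge0//; first by rewrite lee_fin ltW.
  by rewrite lee_fin; apply: hC; exact: cell_of_near.
by have [] := Kfun_cell f t0.
Qed.

Lemma le_weighted_K_norm q sigma a : 0 < q -> rvar 0 (fun x => a (expR x)) ->
  exists2 C : R, (0 < C)%R & forall f D P,
  (forall j, P j -> cell j `<=` D) ->
  lqnorm q (Kseq X0 X1 sigma a f P) <=
    C%:E * weighted_K_norm X0 X1 sigma q a D f.
Proof.
move=> q0 ra; have [C C0 hC] := rvar_near 1%R (rvar_weight sigma ra).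
have [M M0 hM] := le_Lq_on q0.
exists (C * M)%R; first by rewrite mulr_gt0.
move=> f D P DP.
have s0 j : 0 <= Kseq X0 X1 sigma a f P j by apply: Kseq_ge0; exact: ra.1.
rewrite (lqnorm_scale q0 C0)//.
rewrite EFinM -muleA; apply: lee_wpmul2l; first by rewrite lee_fin ltW.
apply: hM => j; first by rewrite mule_ge0// lee_fin invr_ge0 ltW.
rewrite /Kseq; case: ifPn => [Pj|]; last by left; rewrite mule0.
right=> t jt; split; first exact: DP jt.
have /cellP[t0 tj] := jt.
have w0 (x : R) : (0 < expR (- (sigma * x)) * a (expR x))%R.
  by rewrite mulr_gt0 ?expR_gt0//; exact: ra.1.
rewrite weight_split// [in leRHS]EFinM -[leRHS]muleA; apply: lee_wpmul2l.
  by rewrite lee_fin powR_ge0.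
rewrite muleA -EFinM; apply: lee_pmul; rewrite ?Kfun_ge0 ?expR_gt0//.
- by rewrite lee_fin mulr_ge0 ?invr_ge0// ltW.
- rewrite lee_fin ler_pdivrMl//; apply: hC.
  by rewrite distrC -tj; exact: cell_of_near.
- by rewrite -tj; have [] := Kfun_cell f t0.
Qed.

Lemma interp_norm_Kseq q sigma a : 0 < q -> rvar 0 (fun x => a (expR x)) ->
  exists2 C : R, (0 < C)%R & forall f,
  interp_norm X0 X1 sigma q a f <=
    C%:E * lqnorm q (Kseq X0 X1 sigma a f xpredT) /\
  lqnorm q (Kseq X0 X1 sigma a f xpredT) <=
    C%:E * interp_norm X0 X1 sigma q a f.
Proof.
move=> q0 ra; have [C C0 hC] := weighted_K_norm_le sigma q0 ra.
have [D D0 hD] := le_weighted_K_norm sigma q0 ra.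
have s0 f j : 0 <= Kseq X0 X1 sigma a f xpredT j.
  by apply: Kseq_ge0; exact: ra.1.
exists (C + D)%R; first exact: addr_gt0.
move=> f; split.
  apply: le_trans (hC f `]0%R, +oo[%classic xpredT _) _.
    by move=> t; rewrite /= in_itv/= andbT.
  apply: lee_wpmul2r; first exact: lqnorm_ge0.
  by rewrite lee_fin lerDl ltW.
apply: le_trans (hD f `]0%R, +oo[%classic xpredT _) _.
  by move=> j _ t /cell_pos; rewrite /= in_itv/= andbT.
apply: lee_wpmul2r; first exact: Lnorm_ge0.
by rewrite lee_fin lerDr ltW.
Qed.

Lemma interpL_norm_le r b q sigma a : 0 < r -> 0 < q ->
  rvar 0 (fun x => a (expR x)) -> rvar 0 (fun x => b (expR x) / a (expR x))%R ->
  exists2 C : R, (0 < C)%R & forall f,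
  interpL_norm X0 X1 sigma r b q a f <= C%:E *
    lqnorm r (fun i : int => (b (expR i%:~R) / a (expR i%:~R))%:E *
      lqnorm q (Kseq X0 X1 sigma a f (fun l => l <= i)%R)).
Proof.
move=> r0 q0 ra rba; have [C C0 hC] := weighted_K_norm_le sigma q0 ra.
have [M M0 hM] := Lq_on_le r0; have [D D0 hD] := rvar_near 1%R rba.
have s0 f P j : 0 <= Kseq X0 X1 sigma a f P j by apply: Kseq_ge0; exact: ra.1.
have e0 (x : R) : (0 < b (expR x) / a (expR x))%R := rba.1 x.
exists (M * (D * C))%R; first by rewrite !mulr_gt0.
move=> f; rewrite [in leRHS]EFinM -[leRHS]muleA -lqnormZ ?mulr_gt0//; last first.
  by move=> i; rewrite mule_ge0 ?lqnorm_ge0// lee_fin ltW.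
apply: hM => [j|t].
  apply: mule_ge0; first by rewrite lee_fin mulr_ge0// ltW.
  by rewrite mule_ge0 ?lqnorm_ge0// lee_fin ltW.
rewrite /= in_itv/= andbT => t0; split=> //.
have -> : (b t / a t = b (expR (ln t)) / a (expR (ln t)))%R by rewrite lnK.
rewrite mule_ge0 ?Lnorm_ge0//=; last first.
  by rewrite lee_fin mulr_ge0 ?powR_ge0// ltW.
rewrite EFinM -muleA; apply: lee_wpmul2l; first by rewrite lee_fin powR_ge0.
rewrite (EFinM D) muleACA -EFinM.
apply: lee_pmul; rewrite ?Lnorm_ge0//; first by rewrite lee_fin ltW.
  by rewrite lee_fin; apply: hD; exact: cell_of_near.
apply: hC => s; rewrite /= in_itv/= => /andP[s0' st]; split=> //.
by apply: cell_of_le => //; exact: ltW.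
Qed.

(** The cell j - 1 lies in (0, t) for every t >= e^j, so the inner norm is bounded below uniformly
    in such t, and the outer norm of what is left is a tail of b / a. *)
Lemma le_interpL_norm r b q sigma a : 0 < r -> 0 < q ->
  rvar 0 (fun x => a (expR x)) -> rvar 0 (fun x => b (expR x) / a (expR x))%R ->
  exists2 C : R, (0 < C)%R & forall f (j : int),
  Kfun X0 X1 (expR j%:~R) f \is a fin_num ->
  (expR (- (sigma * j%:~R)) * a (expR j%:~R))%:E * Kfun X0 X1 (expR j%:~R) f *
    lqnorm r (tail (fun x => b (expR x) / a (expR x))%R j) <=
  C%:E * interpL_norm X0 X1 sigma r b q a f.
Proof.
move=> r0 q0 ra rba; have [C C0 hC] := le_weighted_K_norm sigma q0 ra.
have [M M0 hM] := le_Lq_on r0; have [D D0 hD] := rvar_near 1%R rba.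
have [N N0 hN] := rvar_near 1%R (rvar_weight sigma ra).
have s0 f P j : 0 <= Kseq X0 X1 sigma a f P j by apply: Kseq_ge0; exact: ra.1.
have e0 (x : R) : (0 < b (expR x) / a (expR x))%R := rba.1 x.
have w0 (x : R) : (0 < expR (- (sigma * x)) * a (expR x))%R.
  by rewrite mulr_gt0 ?expR_gt0//; exact: ra.1.
have K0 (x : R) f : 0 <= Kfun X0 X1 (expR x) f.
  by apply: Kfun_ge0 => //; exact: expR_gt0.
pose L := (N * expR 1 * C * D)%R.
have L0 : (0 < L)%R by rewrite !mulr_gt0// expR_gt0.
exists (L * M)%R; first by rewrite mulr_gt0.
move=> f j Kfin.
pose y := ((expR (- (sigma * j%:~R)) * a (expR j%:~R)) *
  fine (Kfun X0 X1 (expR j%:~R) f))%R.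
have yE : (expR (- (sigma * j%:~R)) * a (expR j%:~R))%:E *
  Kfun X0 X1 (expR j%:~R) f = y%:E by rewrite /y [in RHS]EFinM fineK.
have y0 : (0 <= y)%R by rewrite mulr_ge0 ?fine_ge0// ltW.
(* The cell just below [t] already carries a fixed fraction of the inner norm. *)
have hy t : (0 < t)%R -> (j <= cell_of t)%R -> y%:E <= (N * expR 1 * C)%:E *
    weighted_K_norm X0 X1 sigma q a `]0%R, t[ f.
  move=> t0 jt; rewrite [in leRHS]EFinM -muleA.
  apply: le_trans (lee_wpmul2l _ (hC f _ (pred1 (j - 1)%R) _)).
  - have := lqnorm_term (j - 1)%R q0 (s0 f (pred1 (j - 1)%R)).
    rewrite {1}/Kseq /= eqxx => h.
    apply: le_trans (lee_wpmul2l _ h); last first.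
      by rewrite lee_fin mulr_ge0 ?expR_ge0// ltW.
    rewrite -yE (EFinM N) muleACA -EFinM.
    have jj : (`|j%:~R - (j - 1)%:~R : R| <= 1)%R.
      by rewrite rmorphB/= opprB addrCA subrr addr0 normr1.
    apply: lee_pmul => //; first by rewrite lee_fin ltW.
      by rewrite lee_fin; apply: hN.
    apply: le_trans (Kfun_scale f n0 n1 (expR_gt0 (j - 1)%:~R) _) _.
      by rewrite ler_expR ler_int gerDl.
    apply: lee_wpmul2r => //.
    by rewrite lee_fin -expRB rmorphB/= opprB addrCA subrr addr0.
  - by rewrite lee_fin mulr_ge0 ?expR_ge0// ltW.
  - move=> l /eqP -> s sl; have /cellP[s0' sE] := sl.
    rewrite /= in_itv/= s0'/= ltNge; apply/negP => ts.
    by have := cell_of_le t0 ts; rewrite sE; lia.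
rewrite yE; have t0 l : 0 <= tail (fun x => b (expR x) / a (expR x))%R j l.
  exact: tail_ge0.
apply: (@le_trans _ _ (lqnorm r (fun i => y%:E *
    tail (fun x => b (expR x) / a (expR x))%R j i))).
  have [->|yn0] := eqVneq y 0%R.
    by rewrite mul0e lqnorm_ge0// => i; rewrite mul0e.
  have y1 : (0 < y)%R by rewrite lt0r yn0.
  by rewrite lqnormZ.
rewrite (lqnorm_scale r0 L0); last by move=> i; rewrite mule_ge0.
rewrite (EFinM L M) -[leRHS]muleA; apply: lee_wpmul2l; first by rewrite lee_fin ltW.
apply: hM => i; first by rewrite !mule_ge0// lee_fin invr_ge0 ltW.
rewrite /tail; case: ifPn => ji; last by left; rewrite !mule0.
right=> t it; have /cellP[t0' tE] := it; split.
  by rewrite /= in_itv/= t0'.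
rewrite [in leRHS]EFinM -[leRHS]muleA; apply: lee_wpmul2l.
  by rewrite lee_fin powR_ge0.
have -> : (b t / a t = b (expR (ln t)) / a (expR (ln t)))%R by rewrite lnK.
have jt : (j <= cell_of t)%R by rewrite tE.
have Q0 : (0 < N * expR 1 * C)%R by rewrite !mulr_gt0// expR_gt0.
rewrite -!EFinM [leLHS](_ : _ = (D^-1 * (b (expR i%:~R) / a (expR i%:~R)))%:E *
  ((N * expR 1 * C)^-1 * y)%:E); last first.
  by rewrite -EFinM /L; congr EFin; field; rewrite !gt_eqF//; apply: ra.1.
apply: lee_pmul; rewrite ?lee_fin.
- by rewrite mulr_ge0 ?invr_ge0// ltW.
- by rewrite mulr_ge0 ?invr_ge0// ltW.
- rewrite ler_pdivrMl//; apply: hD.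
  by rewrite distrC -tE; exact: cell_of_near.
- by rewrite EFinM lee_pdivrMl//; exact: hy.
Qed.

End weighted_norms.

(** * Change of variable *)

Section change_of_variable.
Context {R : realType}.
Variables (q : \bar R) (t : R) (rho : R -> R).
Hypotheses (q_gt0 : (0 < q)%E) (t_gt0 : 0 < t) (rrho : rvar t rho).

Let L (x : R) := ln (rho x).

(** Half of the index [t] survives the slowly varying factor as a linear lower growth rate; the
    constants of regular variation become the additive error [D]. *)
Lemma ln_rvar_growth : exists D mu : R, [/\ 0 < D, 0 < mu &
  forall x y, x <= y -> t / 2 * (y - x) - D <= L y - L x <= mu * (y - x) + D].
Proof.
have [rho0 hrho] := rrho.
have t2 : t / 2 < t by rewrite ltr_pdivrMr// ltr_pMr// ltr1n.
have [C C0 hC] := rvar_incr rrho t2.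
have [M M0 hM] := hrho _ ltr01.
exists (`|ln C| + `|ln M| + 1), (t + 1); split.
- by rewrite ltr_wpDl// addr_ge0.
- by rewrite addr_gt0.
move=> x y xy.
have C1 := ler_norm (ln C); have M1 := ler_norm (ln M).
have C2 := normr_ge0 (ln C); have M2 := normr_ge0 (ln M).
have := hC _ _ xy; rewrite -ler_ln ?posrE ?mulr_gt0 ?expR_gt0//.
rewrite !lnM ?posrE ?mulr_gt0 ?expR_gt0// expRK -/(L x) -/(L y) => h1.
have := hM x y; rewrite -ler_ln ?posrE ?mulr_gt0 ?expR_gt0//.
rewrite !lnM ?posrE ?mulr_gt0 ?expR_gt0// expRK -/(L x) -/(L y) => h2.
rewrite ger0_norm ?subr_ge0// mul1r in h2.
by apply/andP; split; lra.
Qed.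

(** A first-crossing argument: [L] starts below x far to the left and exceeds x eventually, and a
    unit step raises it by at most mu + D, so the last integer before the first crossing is close
    enough. *)
Lemma ln_rvar_dense : exists2 m : R, 0 < m &
  forall x : R, exists j : int, `|x - L j%:~R| <= m.
Proof.
have [D [mu [D0 mu0 hL]]] := ln_rvar_growth.
have t2 : 0 < t / 2 by rewrite divr_gt0.
exists (mu + D) => [|x]; first exact: addr_gt0.
have arch z : exists n : nat, z < t / 2 * n%:R.
  exists (Num.truncn (z / (t / 2))).+1.
  by rewrite mulrC -ltr_pdivrMr//; exact: truncnS_gt.
have [N hN] := arch (L 0 + D - x).
have LN : L (- (N%:Z))%:~R <= x.
  have := hL (- (N%:Z))%:~R 0; rewrite rmorphN/= oppr_le0 ler0n => /(_ isT).
  by rewrite opprK add0r => /andP[h _]; lra.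
have ex : exists n : nat, x < L (- N%:Z + n%:Z)%:~R.
  have [n hn] := arch (x - L (- (N%:Z))%:~R + D); exists n.
  have := hL (- (N%:Z))%:~R (- N%:Z + n%:Z)%:~R.
  rewrite ler_int lerDl => /(_ isT); rewrite rmorphD/= addrAC subrr add0r.
  by move=> /andP[h _]; lra.
case: (ex_minnP ex) => -[|n] hn hmin.
  by move: hn; rewrite addr0 ltNge LN.
have Ln : L (- N%:Z + n%:Z)%:~R <= x.
  by rewrite leNgt; apply/negP => /hmin; rewrite ltnn.
exists (- N%:Z + n%:Z); rewrite ger0_norm ?subr_ge0//.
have := hL (- N%:Z + n%:Z)%:~R (- N%:Z + n.+1%:Z)%:~R.
rewrite ler_int lerD2l lez_nat leqnSn => /(_ isT) /andP[_].
rewrite -rmorphB/= (_ : - N%:Z + n.+1%:Z - (- N%:Z + n%:Z) = 1); last by lia.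
by move: hn; lra.
Qed.

(* Both directions are instances of the kernel lemma with the kernel
   [expR (- `|k - L j|)], whose rows and columns are uniformly summable. *)
Lemma lqnorm_change_of_variable : exists2 m : R, 0 < m & forall c : R, 0 < c ->
  exists2 C : R, 0 < C & forall G : R -> \bar R, (forall x, (0 <= G x)%E) ->
  (forall x y, `|y - x| <= m -> (G y <= c%:E * G x)%E) ->
  (lqnorm q (fun k : int => G k%:~R) <=
     C%:E * lqnorm q (fun j : int => G (L j%:~R)))%E /\
  (lqnorm q (fun j : int => G (L j%:~R)) <=
     C%:E * lqnorm q (fun k : int => G k%:~R))%E.
Proof.
have [D [mu [D0 mu0 hL]]] := ln_rvar_growth.
have [m m0 hm] := ln_rvar_dense.
have t2 : 0 < t / 2 by rewrite divr_gt0.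
pose ker (k j : int) : R := expR (- `|k%:~R - L j%:~R|).
have ker0 k j : (0 <= (ker k j)%:E)%E by rewrite lee_fin expR_ge0.
have [M M0 hM] := lqnorm_decay q_gt0 (ltr01 : (0 < 1 :> R)).
have [N N0 hN] := lqnorm_decay q_gt0 t2.
have col j : (lqnorm q (fun k => (ker k j)%:E) <= (expR 1 * M)%:E)%E.
  pose k0 := Num.floor (L j%:~R).
  apply: (@le_trans _ _
    (lqnorm q (fun k => (expR 1)%:E * (decay 1 k k0)%:E)%E)).
    apply: le_lqnorm => // k.
    rewrite -EFinM lee_fin /ker /decay -expRD ler_expR mul1r.
    have := ler_distD (L j%:~R) k%:~R (k0%:~R : R).
    have : `|L j%:~R - k0%:~R| <= 1.
      have /andP[a b] := floor_itv (L j%:~R).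
      rewrite ger0_norm ?subr_ge0// lerBlDl.
      by rewrite -[X in _ <= _ + X](mulr1z 1) -rmorphD/=; exact: ltW.
    by lra.
  rewrite EFinM; apply: le_trans (lqnormZ_le q_gt0 (expR_ge0 1) _) _.
    by move=> k; rewrite lee_fin expR_ge0.
  by apply: lee_wpmul2l; rewrite ?lee_fin ?expR_ge0.
(* If [L j0] is within m of k, the lower growth bound keeps [L j] at distance at least (t/2) |j -
   j0| - D from [L j0]; m and D go into the constant. *)
have row k : (lqnorm q (fun j => (ker k j)%:E) <= (expR (m + D) * N)%:E)%E.
  have [j0 hj0] := hm k%:~R.
  apply: (@le_trans _ _
    (lqnorm q (fun j => (expR (m + D))%:E * (decay (t / 2) j j0)%:E)%E)).
    apply: le_lqnorm => // j.
    rewrite -EFinM lee_fin /ker /decay -expRD ler_expR.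
    suff : t / 2 * `|j%:~R - j0%:~R| - D <= `|L j%:~R - L j0%:~R|.
      have := ler_distD k%:~R (L j%:~R) (L j0%:~R).
      by rewrite (distrC (L j%:~R) k%:~R); lra.
    have [jj|/ltW jj] := leP j j0.
      have := hL j%:~R j0%:~R; rewrite ler_int jj => /(_ isT) /andP[h _].
      rewrite (distrC (j%:~R : R)) ger0_norm ?subr_ge0 ?ler_int//.
      by apply: le_trans h _; rewrite distrC ler_norm.
    have := hL j0%:~R j%:~R; rewrite ler_int jj => /(_ isT) /andP[h _].
    rewrite ger0_norm ?subr_ge0 ?ler_int//.
    by apply: le_trans h _; rewrite ler_norm.
  rewrite EFinM; apply: le_trans (lqnormZ_le q_gt0 (expR_ge0 _) _) _.
    by move=> j; rewrite lee_fin expR_ge0.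
  by apply: lee_wpmul2l; rewrite ?lee_fin ?expR_ge0.
(* One distance for both directions: m from the density of the values of [L], 1 from rounding [L j]
   down to an integer. *)
exists (m + 1); first by rewrite addr_gt0.
move=> c c0.
pose e := c * expR (m + 1).
have e0 : 0 < e by rewrite mulr_gt0// expR_gt0.
have cM0 : 0 < expR 1 * M by rewrite mulr_gt0// expR_gt0.
have rN0 : 0 < expR (m + D) * N by rewrite mulr_gt0// expR_gt0.
exists ((expR 1 * M + expR (m + D) * N) * e).
  by rewrite mulr_gt0// addr_gt0.
move=> G G0 hG.
have eG0 x : (0 <= e%:E * G x)%E by rewrite mule_ge0// lee_fin ltW.
have near (k j : int) : `|k%:~R - L j%:~R| <= m + 1 ->
    (G k%:~R <= (ker k j)%:E * (e%:E * G (L j%:~R)))%E /\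
    (G (L j%:~R) <= (ker k j)%:E * (e%:E * G k%:~R))%E.
  move=> kj; have ek : c <= ker k j * e.
    rewrite /ker /e mulrCA -[leLHS]mulr1 ler_pM2l// -expRD -[leLHS]expR0 ler_expR.
    by lra.
  by split; rewrite muleA -EFinM; [apply: le_trans (hG _ _ kj) _|
    rewrite distrC in kj; apply: le_trans (hG _ _ kj) _];
    apply: lee_wpmul2r; rewrite ?lee_fin.
split.
  apply: le_trans (lqnorm_kernel1 q_gt0 ker0 (fun j : int => eG0 (L j%:~R)) _ col _) _.
  - by move=> k; exact: G0.
  - move=> k; have [j hj] := hm k%:~R; exists j.
    by have [] := near k j _ => //; apply: (le_trans hj); rewrite lerDl.
  under eq_lqnorm do rewrite muleA -EFinM.
  apply: le_trans (lqnormZ_le q_gt0 _ _) _ => //; first by rewrite mulr_ge0 ?ltW.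
  apply: lee_wpmul2r; first exact: lqnorm_ge0.
  by rewrite lee_fin ler_pM2r// lerDl ltW.
apply: le_trans (lqnorm_kernel1 q_gt0 (fun j k => ker0 k j)
  (fun k : int => eG0 k%:~R) _ row _) _.
- by move=> k; exact: G0.
- move=> j; exists (Num.floor (L j%:~R)).
  have [] := near (Num.floor (L j%:~R)) j _ => //.
  have /andP[a b] := floor_itv (L j%:~R).
  rewrite distrC ger0_norm ?subr_ge0// lerBlDl.
  apply: le_trans (ltW b) _; rewrite rmorphD/= lerD2l.
  by rewrite mulr1z lerDr ltW.
under eq_lqnorm do rewrite muleA -EFinM.
apply: le_trans (lqnormZ_le q_gt0 _ _) _ => //; first by rewrite mulr_ge0 ?ltW.
apply: lee_wpmul2r; first exact: lqnorm_ge0.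
by rewrite lee_fin ler_pM2r// lerDr ltW.
Qed.

End change_of_variable.

(** * The outer couple *)

Section outer_couple.
Context (R : realType) (k : scalar_kind).
Context (V : topologicalLmodType (scalar_field R k)).
Variables (A0 A1 : qspace V) (th1 : R) (r0 r1 q1 : \bar R) (a1 b0 b1 : R -> R).
Hypotheses (lA0 : qlinear A0) (lA1 : qlinear A1).
Hypotheses (r0_gt0 : (0 < r0)%E) (r1_gt0 : (0 < r1)%E) (q1_gt0 : (0 < q1)%E).
Hypotheses (ra1 : rvar 0 (fun x => a1 (expR x))).
Hypotheses (rb0 : rvar 0 (fun x => b0 (expR x))).
Hypotheses (rba : rvar 0 (fun x => b1 (expR x) / a1 (expR x))).
Hypothesis tail0 : (tail_norm r0 b0 1 < +oo)%E.
Hypothesis tail1 : (tail_norm r1 (fun s => (b1 s / a1 s)%R) 1 < +oo)%E.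

Let c x := fine (tail_norm r0 b0 (expR x)).
Let d x := fine (tail_norm r1 (fun s => b1 s / a1 s) (expR x)).
Let rho x := expR (th1 * x) * (c x / (a1 (expR x) * d x)).
Let X0 := interp A0 A1 0 r0 b0.
Let X1 := interpL A0 A1 th1 r1 b1 q1 a1.
Local Notation S := (sum_space A0 A1).
Local Notation phi := (logK A0 A1).

Let n0 : nneg_qnorm A0 := qlinear_nneg lA0.
Let n1 : nneg_qnorm A1 := qlinear_nneg lA1.

Lemma outer_nneg : nneg_qnorm X0 /\ nneg_qnorm X1.
Proof. by split=> f _; exact: Lnorm_ge0. Qed.

Lemma outer_sum f : sum_space X0 X1 f -> S f.
Proof.
by move=> [f0 [f1 [[s0 _] [s1 _] ->]]]; exact: sum_spaceD.
Qed.

Lemma rvar_rho : rvar th1 rho.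
Proof.
have [rc _] := tail_norm_rvar r0_gt0 rb0 tail0.
have [rd _] := tail_norm_rvar r1_gt0 rba tail1.
rewrite -[th1]addr0; apply: rvarM; first exact: rvar_exp.
rewrite -[0]addr0; apply: rvarM => //.
by rewrite -oppr0; apply: rvarV; rewrite -[0]addr0; exact: rvarM.
Qed.

(** Each norm of the outer couple dominates the value phi(j) times a tail norm: [c j] for the first,
    and e^(-th1 j) a1 d j for the second. The ratio of these two factors is exactly [rho j], so the
    quasi-triangle inequality for phi over an arbitrary splitting of f gives the claim. *)
Lemma le_outer_Kfun : exists2 C : R, 0 < C & forall f (j : int), S f ->
  ((c j%:~R * phi f j%:~R)%:E <= C%:E * Kfun X0 X1 (rho j%:~R) f)%E.
Proof.
have [rc [C3 C30 hC3]] := tail_norm_rvar r0_gt0 rb0 tail0.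
have [rd [C4 C40 hC4]] := tail_norm_rvar r1_gt0 rba tail1.
have [C1 C10 hC1] := interp_norm_Kseq n0 n1 0 r0_gt0 rb0.
have [C2 C20 hC2] := le_interpL_norm n0 n1 th1 r1_gt0 q1_gt0 ra1 rba.
have [C5 C50 hC5] := logKD lA0 lA1.
have c0 x : 0 < c x := rc.1 x.
have d0 x : 0 < d x := rd.1 x.
have a0 x : 0 < a1 (expR x) := ra1.1 x.
have rho0 x : 0 < rho x := rvar_rho.1 x.
have h0 f (j : int) : S f ->
    ((c j%:~R * phi f j%:~R)%:E <= (C3 * C1)%:E * qnorm X0 f)%E.
  move=> sf; have p0 := logK_ge0 lA0 lA1 f j%:~R.
  rewrite mulrC EFinM.
  apply: le_trans (lee_wpmul2l _ (hC3 j).2) _; first by rewrite lee_fin.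
  rewrite muleCA [in leRHS]EFinM -[leRHS]muleA.
  apply: lee_wpmul2l; first by rewrite lee_fin ltW.
  apply: le_trans (hC1 f).2.
  have t0 i : (0 <= tail (fun u => b0 (expR u)) j i)%E.
    by apply: tail_ge0; exact: rb0.1.
  have [->|pn0] := eqVneq (phi f j%:~R) 0.
    by rewrite mul0e lqnorm_ge0// => i; apply: Kseq_ge0 => //; exact: rb0.1.
  rewrite -lqnormZ//; last by rewrite lt0r pn0.
  apply: le_lqnorm => // i; first by rewrite mule_ge0// lee_fin.
  rewrite /tail; case: ifPn => ji; last first.
    by rewrite mule0; apply: Kseq_ge0 => //; exact: rb0.1.
  rewrite /Kseq /= mul0r oppr0 expR0 mul1r -logKE// muleC.
  apply: lee_wpmul2l; first by rewrite lee_fin ltW//; exact: rb0.1.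
  by rewrite lee_fin logK_mono// ler_int.
have h1 f (j : int) : S f ->
    ((c j%:~R * phi f j%:~R)%:E <=
      (rho j%:~R)%:E * ((C4 * C2)%:E * qnorm X1 f))%E.
  move=> sf; have p0 := logK_ge0 lA0 lA1 f j%:~R.
  have -> : c j%:~R * phi f j%:~R = rho j%:~R *
      (expR (- (th1 * j%:~R)) * a1 (expR j%:~R) * phi f j%:~R * d j%:~R).
    rewrite /rho expRN; field.
    by rewrite !gt_eqF ?expR_gt0.
  rewrite EFinM; apply: lee_wpmul2l; first by rewrite lee_fin ltW.
  rewrite [in leLHS]EFinM.
  apply: le_trans (lee_wpmul2l _ (hC4 j).2) _.
    by rewrite lee_fin !mulr_ge0 ?expR_ge0// ltW.
  rewrite muleCA [in leRHS]EFinM -[leRHS]muleA.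
  apply: lee_wpmul2l; first by rewrite lee_fin ltW.
  rewrite [in leLHS]EFinM logKE//; apply: hC2.
  by rewrite Kfun_fin// expR_gt0.
have C310 : 0 < C3 * C1 by rewrite mulr_gt0.
have C420 : 0 < C4 * C2 by rewrite mulr_gt0.
exists (C5 * (C3 * C1 + C4 * C2)); first by rewrite mulr_gt0// addr_gt0.
move=> f j sf; have [m0 m1] := outer_nneg.
have D0 : 0 < C5 * (C3 * C1 + C4 * C2) by rewrite mulr_gt0// addr_gt0.
rewrite -lee_pdivrMl//.
apply: le_ereal_inf_tmp => _ [f0 [f1 [cf0 cf1 fE ->]]].
rewrite lee_pdivrMl//.
have sf0 : S f0 by have [] := cf0.
have sf1 : S f1 by have [] := cf1.
apply: (@le_trans _ _ (C5%:E * ((c j%:~R * phi f0 j%:~R)%:E +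
    (c j%:~R * phi f1 j%:~R)%:E))%E).
  rewrite -EFinD -EFinM lee_fin -mulrDr mulrCA ler_wpM2l ?(ltW (c0 _))//.
  by rewrite fE; exact: hC5.
rewrite (EFinM C5) -muleA; apply: lee_wpmul2l; first by rewrite lee_fin ltW.
rewrite ge0_muleDr ?m0 ?mule_ge0 ?m1// ?lee_fin ?(ltW (rho0 _))//.
apply: leeD.
  apply: le_trans (h0 _ j sf0) _; apply: lee_wpmul2r; first exact: m0.
  by rewrite lee_fin lerDl ltW.
apply: le_trans (h1 _ j sf1) _; rewrite muleCA.
apply: lee_wpmul2r; last by rewrite lee_fin lerDr ltW.
by rewrite mule_ge0 ?m1// lee_fin ltW.
Qed.

Variables (alpha beta : R) (W : R -> R).
Hypotheses (th1_lt1 : th1 < 1) (alpha_gt0 : 0 < alpha) (beta_gt0 : 0 < beta).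
Hypotheses (rW : rvar (- alpha) W) (rV : rvar beta (fun x => W x * rho x)).

(** The head inequality bounds the first norm of g, the tail inequality the second norm of h, each
    with its own decay rate. Because [s0] and [s1] are real numbers the two norms are finite, which
    also places f in the sum of the outer spaces. *)
Lemma outer_Kfun_le : exists d0 d1 C : R, [/\ 0 < d0, 0 < d1, 0 < C &
  forall f (j : int) (s0 s1 : R), S f ->
  (forall l : int,
    decay d0 l j * (W l%:~R * c l%:~R * phi f l%:~R) <= s0) ->
  (forall l : int,
    decay d1 l j * (W l%:~R * c l%:~R * phi f l%:~R) <= s1) ->
  sum_space X0 X1 f /\
  ((W j%:~R)%:E * Kfun X0 X1 (rho j%:~R) f <= (C * (s0 + s1))%:E)%E].
Proof.
have [rc [C3 C30 hC3]] := tail_norm_rvar r0_gt0 rb0 tail0.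
have [rd [C4 C40 hC4]] := tail_norm_rvar r1_gt0 rba tail1.
have [C1 C10 hC1] := interp_norm_Kseq n0 n1 0 r0_gt0 rb0.
have [C2 C20 hC2] := interpL_norm_le n0 n1 th1 r1_gt0 q1_gt0 ra1 rba.
have [K K0 hK] := logK_decomposition lA0 lA1.
have W0 x : 0 < W x := rW.1 x.
have rho0 x : 0 < rho x := rvar_rho.1 x.
have a0 x : 0 < a1 (expR x) := ra1.1 x.
have e0 x : 0 < b1 (expR x) / a1 (expR x) := rba.1 x.
have [d0 d00 [H H0 hH]] := hardy_head r0_gt0 alpha_gt0 rb0.1 rc rW
  (ex_intro2 _ _ C3 C30 (fun j => (hC3 j).1)).
have [d1 d10 [T T0 hT]] := hardy_tail r1_gt0 q1_gt0 th1_lt1 beta_gt0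
  rba.1 ra1 rc rd rW rV (fun x => erefl)
  (ex_intro2 _ _ C4 C40 (fun j => (hC4 j).1)).
exists d0, d1, (C1 * K * H + C2 * K * T); split=> //.
  by rewrite addr_gt0// !mulr_gt0.
move=> f j s0 s1 sf hs0 hs1.
have p0 x : 0 <= phi f x by exact: logK_ge0.
have s00 : 0 <= s0.
  apply: le_trans (hs0 j); rewrite !mulr_ge0//; apply: ltW => //.
  - exact: decay_gt0.
  - exact: rc.1.
have s10 : 0 <= s1.
  apply: le_trans (hs1 j); rewrite !mulr_ge0//; apply: ltW => //.
  - exact: decay_gt0.
  - exact: rc.1.
have [g [h [sg sh fE gh]]] := hK f j%:~R sf.
have hg : ((W j%:~R)%:E * qnorm X0 g <= (C1 * K * H * s0)%:E)%E.
  apply: le_trans (lee_wpmul2l _ (hC1 g).1) _; first by rewrite lee_fin ltW.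
  rewrite muleCA -!mulrA [leRHS]EFinM.
  apply: lee_wpmul2l; first by rewrite lee_fin ltW.
  rewrite -lqnormZ//; last by move=> i; apply: Kseq_ge0 => //; exact: rb0.1.
  rewrite [leRHS]EFinM; apply: le_trans (lee_wpmul2l _ (hH (phi f) j s0 p0 hs0)).
    apply: le_trans (lqnormZ_le r0_gt0 (ltW K0) _).
      apply: le_lqnorm => // i.
        rewrite mule_ge0 ?lee_fin ?(ltW (W0 _))//.
        by apply: Kseq_ge0 => //; exact: rb0.1.
      rewrite /Kseq/= mul0r oppr0 expR0 mul1r -logKE// -!EFinM lee_fin.
      rewrite [leRHS]mulrCA ler_wpM2l ?(ltW (W0 _))// [leRHS]mulrCA.
      by rewrite ler_wpM2l ?(ltW (rb0.1 _))//; have [] := gh i%:~R.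
    by move=> i; rewrite lee_fin !mulr_ge0//; [exact: ltW|exact/ltW/rb0.1].
  by rewrite lee_fin ltW.
have hh : ((W j%:~R * rho j%:~R)%:E * qnorm X1 h <= (C2 * K * T * s1)%:E)%E.
  have Wr0 : 0 < W j%:~R * rho j%:~R by rewrite mulr_gt0.
  apply: le_trans (lee_wpmul2l _ (hC2 h)) _; first by rewrite lee_fin ltW.
  rewrite muleCA -!mulrA [leRHS]EFinM.
  apply: lee_wpmul2l; first by rewrite lee_fin ltW.
  have ks0 i l : (0 <= Kseq A0 A1 th1 a1 h (fun l => (l <= i)%R) l)%E.
    by apply: Kseq_ge0.
  rewrite -lqnormZ//; last first.
    by move=> i; rewrite mule_ge0 ?lqnorm_ge0// lee_fin ltW.
  rewrite [leRHS]EFinM; apply: le_trans (lee_wpmul2l _ (hT (phi f) j s1 p0 hs1)).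
    pose z (i l : int) : \bar R := if (l <= i)%R then
      (expR (- (th1 * l%:~R)) * a1 (expR l%:~R) *
        (if (l%:~R : R) <= j%:~R then expR (l%:~R - j%:~R) * phi f j%:~R
         else phi f l%:~R))%:E else 0%E.
    have z0 i l : (0 <= z i l)%E.
      rewrite /z; case: ifP => // _; rewrite lee_fin !mulr_ge0 ?expR_ge0//.
        exact: ltW.
      by case: ifP => _; rewrite ?mulr_ge0 ?expR_ge0.
    apply: le_trans (lqnormZ_le r1_gt0 (ltW K0) _).
      apply: le_lqnorm => // i.
        by rewrite mule_ge0 ?mule_ge0 ?lqnorm_ge0// lee_fin ltW.
      rewrite muleA -EFinM muleCA.
      apply: lee_wpmul2l.
        by rewrite lee_fin mulr_ge0 ?(ltW Wr0) ?(ltW (e0 _)).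
      apply: le_trans (lqnormZ_le q1_gt0 (ltW K0) (z0 i)).
      apply: le_lqnorm => // l; rewrite /Kseq /z; case: ifP => _; last first.
        by rewrite mule0.
      rewrite -logKE// -!EFinM lee_fin [leRHS]mulrCA ler_wpM2l ?mulr_ge0 ?expR_ge0//.
        exact: ltW.
      by have [] := gh l%:~R.
    move=> i; rewrite mule_ge0 ?lqnorm_ge0//; last exact: z0.
    by rewrite lee_fin mulr_ge0 ?(ltW Wr0) ?(ltW (e0 _)).
  by rewrite lee_fin ltW.
have fin (u : R) (v : R) (z : \bar R) : 0 < u -> (u%:E * z <= v%:E)%E ->
    (z < +oo)%E.
  move=> u0; rewrite -lee_pdivlMl// => /le_lt_trans; apply.
  by rewrite -EFinM ltry.
have cg : carrier X0 g by split=> //; exact: fin hg.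
have ch : carrier X1 h by split=> //; apply: fin hh; rewrite mulr_gt0.
split; first by exists g, h.
have Kgh := Kfun_le (rho j%:~R) cg ch; rewrite -fE in Kgh.
apply: le_trans (lee_wpmul2l _ Kgh) _; first by rewrite lee_fin ltW.
have [m0 m1] := outer_nneg.
rewrite ge0_muleDr ?m0 ?mule_ge0 ?m1 ?lee_fin ?(ltW (rho0 _))//.
rewrite muleA -EFinM; apply: le_trans (leeD hg hh) _.
rewrite -EFinD lee_fin mulrDl; apply: lerD.
  by rewrite ler_wpM2l ?lerDl// ?mulr_ge0// ltW.
by rewrite ler_wpM2l ?lerDr// ?mulr_ge0// ltW.
Qed.

End outer_couple.

(** * From the K-functional estimates to the equivalence of norms *)

Lemma Kfun_near_le (R : realType) (k : scalar_kind)
    (V : topologicalLmodType (scalar_field R k)) (X0 X1 : qspace V) (f : V)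
    (m x y : R) : nneg_qnorm X0 -> nneg_qnorm X1 -> `|y - x| <= m ->
  (Kfun X0 X1 (expR y) f <= (expR m)%:E * Kfun X0 X1 (expR x) f)%E.
Proof.
move=> n0 n1 xym.
have m0 : 0 <= m by apply: le_trans xym.
have K0 : (0 <= Kfun X0 X1 (expR x) f)%E by apply: Kfun_ge0 => //; exact: expR_gt0.
have [xy|/ltW yx] := leP x y.
  apply: le_trans (Kfun_scale f n0 n1 (expR_gt0 x) _) _; first by rewrite ler_expR.
  apply: lee_wpmul2r => //; rewrite lee_fin -expRB ler_expR.
  exact: le_trans (ler_norm _) xym.
apply: (@le_trans _ _ (1 * Kfun X0 X1 (expR x) f)%E).
  by rewrite mul1e; apply: Kfun_mono => //; rewrite ler_expR.
by apply: lee_wpmul2r => //; rewrite lee_fin -[leLHS]expR0 ler_expR.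
Qed.

Theorem theorem16 (R : realType) (k : scalar_kind)
    (V : topologicalLmodType (scalar_field R k)) (A0 A1 : qspace V)
    (theta theta1 : R) (r r0 r1 q1 : \bar R) (a a1 b0 b1 : R -> R) :
  compatible_couple A0 A1 ->
  (exists2 x, (carrier A0 `&` carrier A1) x & x <> 0) ->
  0 < theta < 1 -> 0 < theta1 < 1 ->
  (0 < r)%E -> (0 < r0)%E -> (0 < r1)%E -> (0 < q1)%E ->
  SV a -> SV a1 -> SV b0 -> SV b1 ->
  (tail_norm r0 b0 1 < +oo)%E ->
  (tail_norm r1 (fun s => (b1 s / a1 s)%R) 1 < +oo)%E ->
  let c0 := fun t => fine (tail_norm r0 b0 t) in
  let c1 := fun t => a1 t * fine (tail_norm r1 (fun s => b1 s / a1 s) t) in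
  let rho := fun t => t `^ theta1 * (c0 t / c1 t) in
  let eta := theta * theta1 in
  let a_sharp := fun t => c0 t `^ (1 - theta) * c1 t `^ theta * a (rho t) in
  interp (interp A0 A1 0 r0 b0) (interpL A0 A1 theta1 r1 b1 q1 a1) theta r a
  ≅ interp A0 A1 eta r a_sharp.
Proof.
move=> [_ [lin0 qn0 _] [lin1 qn1 _] _ _] _ /andP[th_gt0 th_lt1].
move=> /andP[th1_gt0 th1_lt1] r_gt0 r0_gt0 r1_gt0 q1_gt0 sva sva1 svb0 svb1.
move=> tail0 tail1 c0 c1 rho eta a_sharp.
have lA0 : qlinear A0 by [].
have lA1 : qlinear A1 by [].
have [n0 n1] := (qlinear_nneg lA0, qlinear_nneg lA1).
have [ra [ra1 [rb0 rb1]]] := (SV_rvar sva, (SV_rvar sva1,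
  (SV_rvar svb0, SV_rvar svb1))).
have rba : rvar 0 (fun x => b1 (expR x) / a1 (expR x)).
  by rewrite -[0]addr0 -{2}oppr0; apply: rvarM => //; exact: rvarV.
have [rc _] := tail_norm_rvar r0_gt0 rb0 tail0.
have [rd _] := tail_norm_rvar r1_gt0 rba tail1.
have rrho := rvar_rho theta1 r0_gt0 r1_gt0 ra1 rb0 rba tail0 tail1.
set c := fun x => fine (tail_norm r0 b0 (expR x)) in rc.
set d := fun x => fine (tail_norm r1 (fun s => b1 s / a1 s) (expR x)) in rd.
set rh := fun x => expR (theta1 * x) * (c x / (a1 (expR x) * d x)) in rrho.
(* The weight of the outer norm evaluated at u = rho(e^x). *)
pose W x := (rh x `^ theta)^-1 * a (rh x).
have rh0 x : 0 < rh x := rrho.1 x.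
have rhoE x : rho (expR x) = rh x by rewrite /rho -expRM (mulrC x).
have rW : rvar (- (theta1 * theta)) W.
  rewrite -[- _]addr0; apply: rvarM; first exact/rvarV/rvar_powR.
  have := rvar_comp ra rrho.
  by under [X in rvar _ X]eq_fun do rewrite lnK ?posrE//.
have W0 x : 0 < W x := rW.1 x.
have rV : rvar (theta1 - theta1 * theta) (fun x => W x * rh x).
  by rewrite addrC; exact: rvarM.
(* This identity is where eta and a# come from: rho^(-theta) contributes e^(-theta theta1 x) and
   (c0/c1)^(-theta), and one more factor c0 gives c0^(1-theta) c1^theta. *)
have sharpE x : expR (- (eta * x)) * a_sharp (expR x) = W x * c x.
  rewrite /a_sharp rhoE /W /c1 -/(d x) /c0 -/(c x).
  have c00 : 0 < c x := rc.1 x.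
  have e00 : 0 < a1 (expR x) * d x by rewrite mulr_gt0//; [exact: ra1.1|exact: rd.1].
  rewrite /rh; set u := ln (c x); set v := ln (a1 (expR x) * d x).
  have -> : c x = expR u by rewrite lnK.
  have -> : a1 (expR x) * d x = expR v by rewrite lnK.
  rewrite -expRN -!expRD -!expRM -expRN -mulrA mulrA -!expRD.
  rewrite [RHS]mulrAC -expRD mulrA -!expRD; congr (expR _ * _).
  by rewrite /eta; ring.
have rsharp : rvar 0 (fun x => a_sharp (expR x)).
  have := rvarM (rvar_exp eta) (rvarM rW rc).
  rewrite (_ : eta + _ = 0); last by rewrite /eta; ring.
  rewrite (_ : (fun x => _) = (fun x => a_sharp (expR x)))//.
  apply/funext => x; rewrite -sharpE mulrA -expRD subrr expR0 mul1r//.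
set X0 := interp A0 A1 0 r0 b0; set X1 := interpL A0 A1 theta1 r1 b1 q1 a1.
have [m0 m1] : nneg_qnorm X0 /\ nneg_qnorm X1 by split=> g _; exact: Lnorm_ge0.
have [Y Y0 hY] := interp_norm_Kseq n0 n1 eta r_gt0 rsharp.
have [Z Z0 hZ] := interp_norm_Kseq m0 m1 theta r_gt0 ra.
(* The distance m must be fixed first, since the oscillation constant over that distance depends on
   it: [N] for the weight and e^m for the K-functional. *)
have [m m_gt0 /(_ _)] := lqnorm_change_of_variable r_gt0 th1_gt0 rrho.
have rw := rvar_weight theta ra.
have [N N0 hN] := rvar_near m rw.
have Ne0 : 0 < N * expR m by rewrite mulr_gt0// expR_gt0.
move=> /(_ _ Ne0)[Q Q0 hQ].
pose G f x : \bar R :=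
  ((expR (- (theta * x)) * a (expR x))%:E * Kfun X0 X1 (expR x) f)%E.
have Kouter0 x f : (0 <= Kfun X0 X1 (expR x) f)%E.
  by apply: Kfun_ge0 => //; exact: expR_gt0.
have G0 f x : (0 <= G f x)%E.
  by rewrite mule_ge0// lee_fin ltW//; exact: rw.1.
have Gnear f x y : `|y - x| <= m -> (G f y <= (N * expR m)%:E * G f x)%E.
  move=> xy; rewrite /G (EFinM N) muleACA -EFinM.
  apply: lee_pmul => //; first by rewrite lee_fin ltW//; exact: rw.1.
    by rewrite lee_fin; exact: hN.
  exact: Kfun_near_le.
have Grho f x : G f (ln (rh x)) = ((W x)%:E * Kfun X0 X1 (rh x) f)%E.
  by rewrite /G lnK ?posrE// /W /powR gt_eqF// -expRN.
have hQf f := hQ (G f) (G0 f) (Gnear f).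
have yE f (j : int) : sum_space A0 A1 f -> Kseq A0 A1 eta a_sharp f xpredT j =
    (W j%:~R * c j%:~R * logK A0 A1 f j%:~R)%:E.
  by move=> sf; rewrite /Kseq/= sharpE [in RHS]EFinM logKE.
have y0 f (j : int) : (0 <= Kseq A0 A1 eta a_sharp f xpredT j)%E.
  by apply: Kseq_ge0 => //; exact: rsharp.1.
have fin (u : R) (z : \bar R) : 0 < u -> (z < +oo -> u%:E * z < +oo)%E.
  by move=> u0; apply: lte_mul_pinfty => //; rewrite lee_fin ltW.
have [B B0 hB] : exists2 C : R, 0 < C & forall f, sum_space A0 A1 f ->
    (interp_norm A0 A1 eta r a_sharp f <=
      C%:E * interp_norm X0 X1 theta r a f)%E.
  have [K K0 hK] := le_outer_Kfun theta1 lA0 lA1 r0_gt0 r1_gt0 q1_gt0 ra1 rb0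
    rba tail0 tail1.
  exists (Y * (K * (Q * Z))); first by rewrite !mulr_gt0.
  move=> f sf; apply: le_trans (hY f).1 _.
  rewrite (EFinM Y) -[leRHS]muleA; apply: lee_wpmul2l; first by rewrite lee_fin ltW.
  apply: (@le_trans _ _
    (K%:E * lqnorm r (fun j : int => G f (ln (rh j%:~R))))%E).
    apply: le_trans (lqnormZ_le r_gt0 (ltW K0) _) => //.
    apply: le_lqnorm => // j; rewrite yE// Grho -mulrA EFinM muleCA.
    by apply: lee_wpmul2l; [rewrite lee_fin ltW|exact: hK].
  rewrite (EFinM K) -[leRHS]muleA; apply: lee_wpmul2l; first by rewrite lee_fin ltW.
  apply: le_trans (hQf f).2 _.
  rewrite (EFinM Q) -[leRHS]muleA; apply: lee_wpmul2l; first by rewrite lee_fin ltW.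
  exact: (hZ f).2.
have [T T0 hT] : exists2 C : R, 0 < C & forall f, sum_space A0 A1 f ->
    (interp_norm A0 A1 eta r a_sharp f < +oo)%E ->
    sum_space X0 X1 f /\ (interp_norm X0 X1 theta r a f <=
      C%:E * interp_norm A0 A1 eta r a_sharp f)%E.
  (* The two rates at the disposal of the Hardy inequalities: theta > 0 makes [W] decrease, theta <
     1 makes [W] times [rh] increase. *)
  have alpha0 : 0 < theta1 * theta by rewrite mulr_gt0.
  have beta0 : 0 < theta1 - theta1 * theta.
    by rewrite subr_gt0 gtr_pMr.
  have [d0 [d1 [K [d00 d10 K0 hK]]]] := outer_Kfun_le lA0 lA1 r0_gt0 r1_gt0
    q1_gt0 ra1 rb0 rba tail0 tail1 th1_lt1 alpha0 beta0 rW rV.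
  have [D D0 hD] := lqnormD r_gt0.
  have [M0 M00 hM0] := lqnorm_sup_decay r_gt0 d00.
  have [M1 M10 hM1] := lqnorm_sup_decay r_gt0 d10.
  exists (Z * (Q * (K * (D * ((M0 + M1) * Y))))).
    by rewrite !mulr_gt0// addr_gt0.
  move=> f sf nf; pose y := Kseq A0 A1 eta a_sharp f xpredT.
  have yfin : (lqnorm r y < +oo)%E by apply: le_lt_trans (hY f).2 _; exact: fin.
  have yf0 l : (0 <= y l)%E := y0 f l.
  (* The smallest admissible bound in [outer_Kfun_le]. It is at most the norm of [y], hence finite,
     so its real value can be used there. *)
  pose s (e : R) (j : int) := ereal_sup (range (fun l => (decay e l j)%:E * y l)%E).
  have s_ge0 e j : (0 <= s e j)%E.
    by apply: le_ereal_sup_tmp; exists ((decay e 0%R j)%:E * y 0%R)%E;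
      [exists 0%R|rewrite mule_ge0// lee_fin ltW// decay_gt0].
  have s_fin e j : 0 < e -> s e j \is a fin_num.
    move=> e0; rewrite ge0_fin_numE//; apply: le_lt_trans yfin.
    apply: ge_ereal_sup => _ [l _ <-].
    apply: le_trans (lqnorm_term l r_gt0 (y0 f)).
    rewrite -[leRHS]mul1e; apply: lee_wpmul2r => //.
    by rewrite lee_fin decay_le1// ltW.
  have sE e (j l : int) : 0 < e ->
      decay e l j * (W l%:~R * c l%:~R * logK A0 A1 f l%:~R) <= fine (s e j).
    move=> e0; rewrite -lee_fin fineK ?s_fin// EFinM -yE//.
    by apply: ereal_sup_ubound; exists l.
  have hj j := hK f j (fine (s d0 j)) (fine (s d1 j)) sf
    (fun l => sE d0 j l d00) (fun l => sE d1 j l d10).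
  split; first exact: (hj 0).1.
  apply: le_trans (hZ f).1 _.
  rewrite (EFinM Z) -[leRHS]muleA; apply: lee_wpmul2l; first by rewrite lee_fin ltW.
  apply: le_trans (hQf f).1 _.
  rewrite (EFinM Q) -[leRHS]muleA; apply: lee_wpmul2l; first by rewrite lee_fin ltW.
  apply: (@le_trans _ _
    (K%:E * lqnorm r (fun j => s d0 j + s d1 j)%E)%E).
    apply: le_trans (lqnormZ_le r_gt0 (ltW K0) _); last first.
      by move=> j; rewrite adde_ge0.
    apply: le_lqnorm => // j; rewrite Grho; apply: le_trans (hj j).2 _.
    by rewrite EFinM EFinD !fineK ?s_fin.
  rewrite (EFinM K) -[leRHS]muleA; apply: lee_wpmul2l; first by rewrite lee_fin ltW.
  apply: le_trans (hD _ _ (s_ge0 d0) (s_ge0 d1)) _.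
  rewrite (EFinM D) -[leRHS]muleA; apply: lee_wpmul2l; first by rewrite lee_fin ltW.
  apply: le_trans (leeD (hM0 y (y0 f)) (hM1 y (y0 f))) _.
  rewrite -ge0_muleDl ?lee_fin ?(ltW M00) ?(ltW M10)// -EFinD EFinM -[leRHS]muleA.
  apply: lee_wpmul2l; first by rewrite lee_fin ltW// addr_gt0.
  exact: (hY f).2.
split; split.
- move=> f [/outer_sum sf nf]; have {}sf := sf lA0 lA1; split=> //.
  exact: le_lt_trans (hB f sf) (fin _ _ _ nf).
- by exists B => // f [sf _]; apply: hB; exact: outer_sum sf.
- move=> f [sf nf]; have [sX le] := hT f sf nf; split=> //.
  exact: le_lt_trans le (fin _ _ _ nf).
- by exists T => // f [sf nf]; exact: (hT f sf nf).2.
Qed.
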